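(* For all $1<\alpha\le2\le\beta<\infty$, $K\ge1$, $D>0$ and integers $k\ge1$ there exists a constant $C_{D,K,\alpha,\beta,k}$, depending only on $D,K,\alpha,\beta,k$, such that the following holds. Let $\Psi\colon\mathbb{R}^n\to\mathbb{R}$ be a convex function satisfying condition (C) and the growth condition $(G_{K,\alpha,\beta})$ (both defined in the context), and let $X$ be a random vector in $\mathbb{R}^n$ whose law is absolutely continuous and satisfies the modified logarithmic Sobolev inequality $mLSI(\Psi,D)$. Let $(E,|\cdot|_E)$ be a separable Banach space, let $A=(a_{i_1,\ldots,i_k})_{i_1,\ldots,i_k=1}^n$ be a symmetric $k$-indexed matrix with entries in $E$, and let $Z=|\langle A,X^{\otimes k}\rangle|_E$. Then for any $p\ge\beta$, $$\|Z-\mathbb{E}Z\|_p\le C_{D,K,\alpha,\beta,k}\sum_{j=1}^k\mathbb{E}\sup_{y^1,\ldots,y^j\in A_{\Psi,p}}\big|\langle A,y^1\otimes\cdots\otimes y^j\otimes X^{\otimes(k-j)}\rangle\big|_E ,$$ where $A_{\Psi,p}=\{x\in\mathbb{R}^n:\Psi^\ast(x)\le p\}$. As a consequence, for any $p\ge\beta$, $$\mathbb{P}\Big(|Z-\mathbb{E}Z|\ge C_{D,K,\alpha,\beta,k}\sum_{j=1}^k\mathbb{E}\sup_{y^1,\ldots,y^j\in A_{\Psi,p}}\big|\langle A,y^1\otimes\cdots\otimes y^j\otimes X^{\otimes(k-j)}\rangle\big|_E\Big)\le e^{-p}$$ (the constants in the two inequalities may differ).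
   Context: Condition (C) for $\Psi\colon\mathbb{R}^n\to[0,\infty]$: (C1) $\Psi(0)=0$ and $\Psi$ is continuous at $0$; (C2) $\Psi(x)>0$ for $x\ne0$; (C3) $\lim_{|x|\to\infty}\Psi(x)=\infty$; (C4) for every $x\in\mathbb{R}^n$ the function $t\mapsto\Psi(tx)$ is left-continuous on $(0,\infty)$; (C5) for every $x\in\mathbb{R}^n$ the function $t\mapsto\Psi(tx)/t$ is non-decreasing on $(0,\infty)$; (C6) $\Psi(x)=\Psi(-x)$ for all $x$. Growth condition $(G_{K,\alpha,\beta})$: for all $x\in\mathbb{R}^n\setminus\{0\}$ and all $t\ge1$, $K^{-1}t^\alpha\le\Psi(tx)/\Psi(x)\le Kt^\beta$. A probability measure $\mu$ satisfies $mLSI(\Psi,D)$ if for every bounded locally Lipschitz $f\colon\mathbb{R}^n\to(0,\infty)$, $$\mathrm{Ent}_\mu f^2\le D\,\mathbb{E}_\mu\Psi\Big(\frac{\nabla f}{f}\Big)f^2,$$ where $\mathbb{E}_\mu$ is integration with respect to $\mu$ and $\mathrm{Ent}_\mu g=\mathbb{E}_\mu g\log g-\mathbb{E}_\mu g\log\mathbb{E}_\mu g$ for $g\ge 0$. Legendre transform: $\Psi^\ast(x)=\sup_{y\in\mathbb{R}^n}(\langle x,y\rangle-\Psi(y))$. Moments: $\|Y\|_p=(\mathbb{E}|Y|^p)^{1/p}$. Tensor notation: for $A$ with entries in $E$ and a real $k$-indexed matrix $B=(b_{i_1,\ldots,i_k})$, $\langle A,B\rangle=\sum_{i_1,\ldots,i_k=1}^na_{i_1,\ldots,i_k}b_{i_1,\ldots,i_k}\in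 E$; for $x^1,\ldots,x^k\in\mathbb{R}^n$, $x^1\otimes\cdots\otimes x^k=(x^1_{i_1}\cdots x^k_{i_k})_{i_1,\ldots,i_k=1}^n$, and $x^{\otimes m}$ is the $m$-fold product of $x$ with itself. $A$ is symmetric if $a_{i_1,\ldots,i_k}=a_{i_{\sigma(1)},\ldots,i_{\sigma(k)}}$ for every permutation $\sigma$ of $\{1,\ldots,k\}$.
   Formalization: The tail bound is stated only for A ≠ 0 (some entry nonzero): for A = 0 both Z and the sum vanish, so the event has probability 1 > e^{-p} and the claim is false; the moment bound is stated for every symmetric A. *)

(* Defs.v *)
From HB Require Import structures.
From mathcomp Require Import all_boot all_order all_algebra.
From mathcomp Require Import perm.
From mathcomp Require Import all_classical all_reals all_analysis.
Export Order.TTheory GRing.Theory Num.Theory.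
Export numFieldNormedType.Exports.

Set Implicit Arguments.
Unset Strict Implicit.
Unset Printing Implicit Defensive.

Local Open Scope classical_set_scope.
Local Open Scope ring_scope.

(* R^n is 'rV[R]_n.  Its library norm is the sup norm; it is used below only
   through its topology and through "locally Lipschitz", which are the same for
   all norms on R^n.  The Euclidean norm is enorm. *)
Definition dotr (R : realType) (n : nat) (x y : 'rV[R]_n) : R :=
  \sum_(i < n) x 0 i * y 0 i.

Definition enorm (R : realType) (n : nat) (x : 'rV[R]_n) : R :=
  Num.sqrt (dotr x x).

Record condition_C (R : realType) (n : nat) (Psi : 'rV[R]_n -> R) : Prop := {
  condition_C_ge0 : forall x, 0 <= Psi x;
  condition_C1 : Psi 0 = 0 /\ {for 0, continuous Psi};
  condition_C2 : forall x : 'rV[R]_n, x != 0 -> 0 < Psi x;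
  condition_C3 : forall M : R, exists r : R,
    forall x, r <= enorm x -> M <= Psi x;
  condition_C4 : forall (x : 'rV[R]_n) (t : R), 0 < t ->
    Psi (s *: x) @[s --> t^'-] --> Psi (t *: x);
  condition_C5 : forall (x : 'rV[R]_n) (s t : R), 0 < s -> s <= t ->
    Psi (s *: x) / s <= Psi (t *: x) / t;
  condition_C6 : forall x, Psi x = Psi (- x)
}.

Definition growth (R : realType) (n : nat) (K alpha beta : R)
    (Psi : 'rV[R]_n -> R) : Prop :=
  forall (x : 'rV[R]_n) (t : R), x != 0 -> 1 <= t ->
    K^-1 * t `^ alpha <= Psi (t *: x) / Psi x <= K * t `^ beta.

(* R^n with its Borel sigma-algebra; the carrier is convertible to 'rV[R]_n *)
Definition borel_rV (R : realType) (n : nat) : measurableType _ :=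
  g_sigma_algebraType (open : set (set 'rV[R]_n)).

(* n-dimensional Lebesgue measure: R^(n+1) is identified with R * R^n by
   (a, v) |-> row_mx a v, and lambda_(n+1) is the product measure
   lambda_1 \x lambda_n; lambda_0 is the unit mass on the one-point space. *)
Fixpoint lebesgue_rV (R : realType) (n : nat) : set (borel_rV R n) -> \bar R :=
  match n with
  | 0 => fun B => (\1_B (0 : 'rV[R]_0))%:E
  | m.+1 => fun B =>
      ((@lebesgue_measure R : set (measurableTypeR R) -> \bar R) \x
       (@lebesgue_rV R m))%E
        [set av : measurableTypeR R * borel_rV R m |
          B (row_mx (av.1%:M : 'M[R]_1) (av.2 : 'rV[R]_m) : 'rV[R]_(1 + m))]
  end.

(* The vector of partial derivatives.  The library's 'D_v f x is total; where f
   is not differentiable (a Lebesgue null set when f is locally Lipschitz) the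
   value is irrelevant, since the law considered is absolutely continuous. *)
Definition grad (R : realType) (n : nat) (f : 'rV[R]_n -> R) (x : 'rV[R]_n) :
    'rV[R]_n :=
  \row_(i < n) 'D_(delta_mx 0 i : 'rV[R]_n) f x.

Definition locally_lipschitz (R : realType) (n : nat) (f : 'rV[R]_n -> R) :
    Prop :=
  forall x : 'rV[R]_n, exists2 U : set 'rV[R]_n, nbhs x U &
    [lipschitz f y | y in U].

Definition Ent (d : measure_display) (T : measurableType d) (R : realType)
    (mu : {measure set T -> \bar R}) (g : T -> R) : \bar R :=
  (\int[mu]_x (g x * ln (g x))%:E
   - (\int[mu]_x (g x)%:E) * lne (\int[mu]_x (g x)%:E))%E.

Definition mLSI (R : realType) (n : nat) (mu : probability (borel_rV R n) R)
    (Psi : 'rV[R]_n -> R) (D : R) : Prop :=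
  forall f : 'rV[R]_n -> R,
    (forall x, 0 < f x) ->
    [bounded f x | x in [set: 'rV[R]_n]] ->
    locally_lipschitz f ->
    (Ent mu (fun x : borel_rV R n => (f x ^+ 2)%R) <=
     D%:E * \int[mu]_x (Psi ((f x)^-1 *: grad f x) * f x ^+ 2)%:E)%E.

Definition legendre (R : realType) (n : nat) (Psi : 'rV[R]_n -> R)
    (x : 'rV[R]_n) : \bar R :=
  ereal_sup [set (dotr x y - Psi y)%:E | y in [set: 'rV[R]_n]].

Definition A_set (R : realType) (n : nat) (Psi : 'rV[R]_n -> R) (p : R) :
    set 'rV[R]_n :=
  [set x | (legendre Psi x <= p%:E)%E].

Definition separable (T : topologicalType) : Prop :=
  exists2 S : set T, countable S & dense S.

Definition tensor (k n : nat) (E : Type) := {ffun 'I_k -> 'I_n} -> E.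

Definition tensor_sym (k n : nat) (E : Type) (A : tensor k n E) : Prop :=
  forall (s : 'S_k) (i : {ffun 'I_k -> 'I_n}), A [ffun l => i (s l)] = A i.

Definition pairing (R : realType) (k n : nat) (E : lmodType R)
    (A : tensor k n E) (B : tensor k n R) : E :=
  \sum_(i : {ffun 'I_k -> 'I_n}) B i *: A i.

(* x^1 (x) ... (x) x^k for xs = [:: x^1; ...; x^k]; meant for size xs = k *)
Definition tprod (R : realType) (k n : nat) (xs : seq 'rV[R]_n) :
    tensor k n R :=
  fun i => \prod_(l < k) xs`_l 0 (i l).
Arguments tprod {R} k {n} xs i.

(* E sup_{y^1, ..., y^j in A_{Psi,p}} |<A, y^1 (x) ... (x) y^j (x) X^{(x)(k-j)}>| *)
Definition Esup (d : measure_display) (T : measurableType d) (R : realType)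
    (P : probability T R) (n k : nat) (X : T -> 'rV[R]_n)
    (E : normedModType R) (A : tensor k n E) (Psi : 'rV[R]_n -> R) (p : R)
    (j : nat) : \bar R :=
  (\int[P]_w ereal_sup
     [set `|pairing A (tprod k (tval y ++ nseq (k - j) (X w)))|%:E |
       y in [set y : j.-tuple 'rV[R]_n |
              forall i : 'I_j, A_set Psi p (tnth y i)]])%E.

(* Main.v *)
(** By duality, [grad g] paired with [A_set Psi p] being at most [h] gives
    [Psi (p / (2 h) *: grad g) <= p].  If moreover [h] has small [p]-th moment and
    [g <= 0] with probability >= 1/2, the modified log-Sobolev inequality applied to
    [v ^ (r / 2)], [v = 1 + ln (1 + e ^ g)], bounds [Ent (v ^ r) / E (v ^ r)] by a
    multiple of [r (r / p) ^ (alpha - 1)], hence [||v||_r / ||v||_(r / 2)] by the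
    exponential of a multiple of [(r / p) ^ (alpha - 1)].  These rates are summable
    along [r = p, p / 2, p / 4, ...], so [||v||_p] is bounded by a constant; around
    a median this yields [||g - E g||_p <= C ||h||_p].

    Let [F_j] be the supremum of [|<A, y^1, ..., y^j, X, ..., X>|] over the [y]'s.
    It is a supremum of countably many polynomials in [X] whose derivatives along
    [A_set Psi p] are at most [(k - j) F_(j+1)], by symmetry of [A].  Smoothing the
    maxima and passing to the limit,
    [||F_j - E F_j||_p <= C k ||F_(j+1)||_p <= C k (E F_(j+1) + ||F_(j+1) - E F_(j+1)||_p)],
    and the downward induction stops at [F_k], which is constant. *)
Require Import Defs.
From mathcomp Require Import all_boot all_order all_algebra.
From mathcomp Require Import all_classical all_reals all_analysis.
From mathcomp Require Import measurable_realfun perm ring lra.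

Set Implicit Arguments.
Unset Strict Implicit.
Unset Printing Implicit Defensive.

Local Open Scope classical_set_scope.
Local Open Scope ring_scope.

(** The inequality accepts only bounded locally Lipschitz test functions, whereas [F_j] is a
    possibly unbounded, non-smooth supremum whose integrability is not known beforehand. Every
    estimate is therefore proved for bounded smooth functions, with constants free of the bound, the
    dimension and the number of functions under the maximum; the limit then yields integrability and
    the moment bound together.

    Two mechanisms make the entropy estimate close. The logarithmic gradient of [v ^ (r / 2)]
    carries a factor [1 / v], and [(H / v) ^ c * v ^ r <= H ^ r + v ^ r] for [c <= r], so the energy
    is bounded by the moment of [v] under study; [c] runs up to [beta], whence [r >= beta]. Duality
    stays scaled to [p] while the gradient is contracted by [r / p]; lower growth turns this into [p
    (r / p) ^ alpha = r (r / p) ^ (alpha - 1)], geometric along halvings because [alpha > 1].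

    Halving has to stop in [[beta, 2 beta)]. There the median condition replaces the missing smaller
    moment. *)

(** * Finite Hahn-Banach for sublinear functionals *)

Section Sublinear.
Context {R : realType} {V : lmodType R}.
Implicit Types (q phi : V -> R) (x y v w : V).

Definition sublinear q :=
  (forall x y, q (x + y) <= q x + q y) /\
  (forall (t : R) x, 0 < t -> q (t *: x) <= t * q x).

Lemma sublinearZ q t x : sublinear q -> 0 < t -> q (t *: x) = t * q x.
Proof.
move=> [_ qZ] t0; apply/eqP; rewrite eq_le qZ //=.
have := qZ t^-1 (t *: x); rewrite invr_gt0 t0 scalerA mulVf ?gt_eqF// scale1r.
by rewrite mulrC ler_pdivlMr// mulrC; apply.
Qed.

Lemma sublinear0 q : sublinear q -> q 0 = 0.
Proof.
move=> qs; have := @sublinearZ q 2 0 qs; rewrite scaler0 => /(_ (ltr0Sn _ _)).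
by lra.
Qed.

Lemma sublinearZ_ge0 q t x : sublinear q -> 0 <= t -> q (t *: x) = t * q x.
Proof.
move=> qs; rewrite le_eqVlt => /orP[/eqP <-|]; last exact: sublinearZ.
by rewrite scale0r mul0r sublinear0.
Qed.

Lemma sublinear_geN q x : sublinear q -> - q x <= q (- x).
Proof.
move=> qs; have := qs.1 x (- x); rewrite subrr sublinear0 // => ?; lra.
Qed.

(** For sublinear [q] this is linearity along the line of [w], even after translation: see [odd_atZ]
    and [odd_atD]. *)
Definition odd_at q w := q (- w) = - q w.

(** Squeeze: [- q w = q (- w) >= q' (- w) >= - q' w >= - q w]. Linearity already gained survives
    every later minorant. *)
Lemma odd_at_le q q' w : sublinear q' -> (forall x, q' x <= q x) ->
  odd_at q w -> odd_at q' w /\ q' w = q w.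
Proof.
rewrite /odd_at => q's le_qq' qw.
have := sublinear_geN w q's; have := le_qq' w; have := le_qq' (- w).
by split; lra.
Qed.

Lemma odd_atZ q w c : sublinear q -> odd_at q w -> q (c *: w) = c * q w.
Proof.
move=> qs qw; have [c0|c0] := lerP 0 c; first exact: sublinearZ_ge0.
rewrite -[c in LHS]opprK scaleNr -scalerN sublinearZ ?oppr_gt0//.
by rewrite qw mulrNN.
Qed.

Lemma odd_atD q w c x : sublinear q -> odd_at q w ->
  q (x + c *: w) = q x + c * q w.
Proof.
move=> qs qw; apply/eqP; rewrite eq_le -{1}(odd_atZ c qs qw) qs.1 /=.
have := qs.1 (x + c *: w) (- c *: w); rewrite (odd_atZ _ qs qw).
by rewrite scaleNr addrK mulNr; lra.
Qed.

Lemma odd_at_sum q (I : Type) (r : seq I) (c : I -> R) (w : I -> V) :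
  sublinear q -> (forall i, odd_at q (w i)) ->
  q (\sum_(i <- r) c i *: w i) = \sum_(i <- r) c i * q (w i).
Proof.
move=> qs qw; elim: r => [|i r IHr]; first by rewrite !big_nil sublinear0.
by rewrite !big_cons addrC odd_atD // IHr addrC.
Qed.

(** With [s = 1 / t] this is the one-sided derivative of [q] at [v] in the direction [x]. *)
Definition odd_ext q v x := inf [set q (x + t *: v) - t * q v | t in [set t | 0 <= t]].

Lemma odd_ext_lb q v x : sublinear q ->
  has_lbound [set q (x + t *: v) - t * q v | t in [set t | 0 <= t]].
Proof.
move=> qs; exists (- q (- x)) => _ [t /= t0 <-].
have := qs.1 (x + t *: v) (- x).
by rewrite addrAC subrr add0r -(sublinearZ_ge0 v qs t0); lra.
Qed.

Lemma odd_ext_le q v x t : sublinear q -> 0 <= t ->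
  odd_ext q v x <= q (x + t *: v) - t * q v.
Proof. by move=> qs t0; apply: ge_inf; [exact: odd_ext_lb | exists t]. Qed.

Lemma odd_ext_ge q v x c : (forall t, 0 <= t -> c <= q (x + t *: v) - t * q v) ->
  c <= odd_ext q v x.
Proof.
move=> h; apply: lb_le_inf; first by exists (q (x + 0 *: v) - 0 * q v), 0 => /=.
by move=> _ [t t0 <-]; apply: h.
Qed.

Lemma odd_ext_le_self q v x : sublinear q -> odd_ext q v x <= q x.
Proof.
by move=> qs; have := odd_ext_le v x qs (lexx 0); rewrite scale0r mul0r addr0 subr0.
Qed.

Lemma odd_ext_sublinear q v : sublinear q -> sublinear (odd_ext q v).
Proof.
move=> qs; split=> [x y|t x t0].
  rewrite -lerBlDr; apply: odd_ext_ge => s s0.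
  rewrite lerBlDr -lerBlDl; apply: odd_ext_ge => t t0.
  rewrite lerBlDl; apply: le_trans (odd_ext_le v (x + y) qs (addr_ge0 s0 t0)) _.
  have := qs.1 (x + s *: v) (y + t *: v).
  by rewrite addrACA -scalerDl mulrDl; lra.
rewrite -ler_pdivrMl //; apply: odd_ext_ge => s s0.
rewrite ler_pdivrMl //.
apply: le_trans (odd_ext_le v _ qs (mulr_ge0 (ltW t0) s0)) _.
by rewrite -scalerA -scalerDr sublinearZ // mulrBr mulrA.
Qed.

Lemma odd_ext_odd q v : sublinear q -> odd_at (odd_ext q v) v /\ odd_ext q v v = q v.
Proof.
move=> qs; have qvs := odd_ext_sublinear v qs.
have vv : odd_ext q v v = q v.
  apply/eqP; rewrite eq_le odd_ext_le_self //=; apply: odd_ext_ge => t t0.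
  have -> : v + t *: v = (1 + t) *: v by rewrite scalerDl scale1r.
  rewrite sublinearZ_ge0 ?addr_ge0//.
  by rewrite mulrDl mul1r addrK.
split => //; apply/eqP; rewrite /odd_at eq_le sublinear_geN // andbT vv.
have := odd_ext_le v (- v) qs ler01.
by rewrite scale1r addNr sublinear0 // mul1r sub0r.
Qed.

(* Hahn-Banach for finitely many directions: each [odd_ext] makes [phi] linear
   along one more vector. *)
Lemma odd_minorant q (x0 : V) (s : seq V) : sublinear q ->
  exists phi, [/\ sublinear phi, forall x, phi x <= q x, phi x0 = q x0 &
    {in x0 :: s, forall w, odd_at phi w}].
Proof.
move=> qs; elim: s => [|v s [phi [phis le_phi phi0 phi_odd]]].
  exists (odd_ext q x0); have [oq eq0] := odd_ext_odd x0 qs; split => //.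
  - exact: odd_ext_sublinear.
  - by move=> x; apply: odd_ext_le_self.
  - by move=> w; rewrite inE => /eqP ->.
have [ov _] := odd_ext_odd v phis.
have es := odd_ext_sublinear v phis.
have le_e x : odd_ext phi v x <= phi x by apply: odd_ext_le_self.
exists (odd_ext phi v); split => //.
- by move=> x; apply: le_trans (le_e x) (le_phi x).
(* [phi] is already odd at [x0], so its value there cannot drop. *)
- rewrite -phi0; apply: (odd_at_le es le_e _).2.
  by apply: phi_odd; rewrite mem_head.
- move=> w; rewrite !inE orbCA => /orP[/eqP -> //|ws].
  by apply: (odd_at_le es le_e _).1; apply: phi_odd; rewrite inE.
Qed.

End Sublinear.

(** * Duality between [Psi] and its polar sets [A_set Psi p] *)

Section Polar.
Context {R : realType} {n : nat}.
Implicit Types (x y z w : 'rV[R]_n) (p h : R).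

Lemma dotrZl (c : R) x y : dotr (c *: x) y = c * dotr x y.
Proof. by rewrite /dotr mulr_sumr; apply: eq_bigr => i _; rewrite mxE mulrA. Qed.

Lemma dotrC x y : dotr x y = dotr y x.
Proof. by apply: eq_bigr => i _; rewrite mulrC. Qed.

Lemma dotrNl x y : dotr (- x) y = - dotr x y.
Proof. by rewrite -scaleN1r dotrZl mulN1r. Qed.

Lemma dotr0l x : dotr 0 x = 0.
Proof. by rewrite -(scale0r (0 : 'rV_n)) dotrZl mul0r. Qed.

Lemma dotr_deltal i x : dotr (delta_mx 0 i) x = x 0 i.
Proof.
rewrite /dotr (bigD1 i) //= big1 ?addr0 ?mxE ?eqxx ?mul1r//.
by move=> j ji; rewrite mxE (negbTE ji) andbF mul0r.
Qed.

Context {Psi : 'rV[R]_n -> R}.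

Lemma A_setP p y : A_set Psi p y <-> forall w, dotr y w - Psi w <= p.
Proof.
split=> [Ay w|h].
  rewrite -lee_fin; apply: le_trans Ay; apply: ereal_sup_ubound.
  by exists w.
by apply: ge_ereal_sup => _ [w _ <-]; rewrite lee_fin.
Qed.

Hypothesis PsiC : condition_C Psi.

Lemma A_set0 p : 0 <= p -> A_set Psi p 0.
Proof.
move=> p0; apply/A_setP => w; rewrite dotr0l sub0r.
by apply: le_trans p0; rewrite oppr_le0; apply: condition_C_ge0.
Qed.

Lemma A_setN p y : A_set Psi p y -> A_set Psi p (- y).
Proof.
move=> /A_setP Ay; apply/A_setP => w; have := Ay (- w).
by rewrite dotrC dotrNl -(condition_C6 PsiC) dotrNl [dotr y w]dotrC.
Qed.

(** Testing the Legendre bound on [delta_mx 0 i], where [Psi] is finite, bounds each coordinate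
    above; evenness of [Psi] bounds it below. This makes all later suprema finite. *)
Lemma A_set_bounded p : exists2 B, 0 < B & forall y i, A_set Psi p y -> `|y 0 i| <= B.
Proof.
exists (1 + \sum_(i < n) (`|p| + Psi (delta_mx 0 i))).
  rewrite ltr_pwDl// sumr_ge0// => i _.
  by rewrite addr_ge0//; apply: condition_C_ge0.
have bnd y i : A_set Psi p y -> y 0 i <= `|p| + Psi (delta_mx 0 i).
  move=> /A_setP /(_ (delta_mx 0 i)); rewrite dotrC dotr_deltal.
  by have := ler_norm p; lra.
move=> y i Ay; have b1 := bnd _ i Ay; have := bnd _ i (A_setN Ay); rewrite mxE => b2.
have : `|p| + Psi (delta_mx 0 i) <= \sum_(i < n) (`|p| + Psi (delta_mx 0 i)).
  rewrite (bigD1 i) //= lerDl sumr_ge0// => j _.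
  by rewrite addr_ge0//; apply: condition_C_ge0.
by rewrite ler_norml => ?; apply/andP; split; lra.
Qed.

Lemma enormZ (c : R) x : enorm (c *: x) = `|c| * enorm x.
Proof. by rewrite /enorm dotrZl dotrC dotrZl mulrA -expr2 sqrtrM ?sqr_ge0// sqrtr_sqr. Qed.

Lemma coord_le_enorm x i : `|x 0 i| <= enorm x.
Proof.
rewrite -sqrtr_sqr /enorm ler_wsqrtr// /dotr (bigD1 i) //= -expr2 lerDl.
by rewrite sumr_ge0// => j _; rewrite -expr2 sqr_ge0.
Qed.

(** By (C3) and (C5), [Psi w >= enorm w / s] once [enorm w > s], and for shorter [w] the pairing is
    at most 1. It serves to show that the top supremum is positive when [A] is not zero. *)
Lemma A_set_delta : exists2 c, 0 < c &
  forall p i, 1 <= p -> A_set Psi p (c *: delta_mx 0 i).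
Proof.
have [r rP] := condition_C3 PsiC 1.
pose s := Num.max r 1; have s1 : 1 <= s by rewrite le_max lexx orbT.
have s0 : 0 < s by lra.
exists s^-1; rewrite ?invr_gt0// => p i p1; apply/A_setP => w.
rewrite dotrZl dotr_deltal; have wi := le_trans (ler_norm _) (coord_le_enorm w i).
have le1 : s^-1 * w 0 i <= s^-1 * enorm w by rewrite ler_pM2l ?invr_gt0.
have [ws|sw] := lerP (enorm w) s.
  have : s^-1 * enorm w <= 1 by rewrite mulrC ler_pdivrMr ?mul1r.
  by have := condition_C_ge0 PsiC w; lra.
have w0 : 0 < enorm w by apply: lt_trans sw.
have Psi1 : 1 <= Psi ((s / enorm w) *: w).
  have sw0 : 0 <= s / enorm w by rewrite divr_ge0 ?ltW.
  by apply: rP; rewrite enormZ (ger0_norm sw0) divfK ?gt_eqF// le_max lexx.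
have := condition_C5 PsiC w (s := s / enorm w) (t := 1).
rewrite scale1r divr1 divr_gt0// ler_pdivrMr// mul1r (ltW sw) => /(_ isT isT).
move=> le2; have : s^-1 * enorm w <= Psi w.
  apply: le_trans le2; rewrite invf_div -[leLHS]mul1r [s^-1 * _]mulrC.
  by rewrite ler_wpM2r// divr_ge0 ?ltW.
lra.
Qed.

Hypothesis Psi_convex : @convex_function R 'rV[R]_n [set: 'rV[R]_n] Psi.

Lemma convex_functionP (t : R) x y : 0 <= t -> t <= 1 ->
  Psi (t *: x + (1 - t) *: y) <= t * Psi x + (1 - t) * Psi y.
Proof.
move=> t0 t1; have t01 : 0 <= t <= 1 by rewrite t0.
exact: (Psi_convex (@Itv01 R t t0 t1) (in_setT x) (in_setT y)).
Qed.

(* The support function of [A_set Psi p]; see [polar_gauge_support]. *)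
Definition polar_gauge p w := inf [set (p + Psi (s *: w)) / s | s in [set s | 0 < s]].

Lemma polar_gauge_le p w s : 0 < p -> 0 < s -> polar_gauge p w <= (p + Psi (s *: w)) / s.
Proof.
move=> p0 s0; apply: ge_inf; last by exists s.
exists 0 => _ [t /= t0 <-]; apply: divr_ge0 (ltW t0).
by apply: addr_ge0; [exact: ltW | exact: condition_C_ge0].
Qed.

Lemma polar_gauge_ge p w c :
  (forall s, 0 < s -> c <= (p + Psi (s *: w)) / s) -> c <= polar_gauge p w.
Proof.
move=> h; apply: lb_le_inf; first by exists ((p + Psi (1 *: w)) / 1), 1 => /=.
by move=> _ [s s0 <-]; apply: h.
Qed.

Lemma polar_gauge_sublinear p : 0 < p -> sublinear (polar_gauge p).
Proof.
move=> p0; split=> [x y|t x t0].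
  rewrite -lerBlDr; apply: polar_gauge_ge => s s0.
  rewrite lerBlDr -lerBlDl; apply: polar_gauge_ge => t t0; rewrite lerBlDl.
  (* The harmonic choice [1 / r = 1 / s + 1 / t] makes [r *: (x + y)] a convex combination of
     [s *: x] and [t *: y]. *)
  pose r := s * t / (s + t); have st0 : 0 < s + t by rewrite addr_gt0.
  have r0 : 0 < r by rewrite divr_gt0 ?mulr_gt0.
  apply: le_trans (polar_gauge_le _ p0 r0) _.
  have stE : 1 - t / (s + t) = s / (s + t) by field; rewrite gt_eqF.
  have := @convex_functionP (t / (s + t)) (s *: x) (t *: y).
  rewrite (divr_ge0 (ltW t0) (ltW st0)) ler_pdivrMr// mul1r lerDr (ltW s0).
  move=> /(_ isT isT).
  rewrite stE !scalerA [t / _ * s]mulrAC [t * s]mulrC [s / _ * t]mulrAC -/r -scalerDr.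
  move=> cvx; rewrite ler_pdivrMr//.
  have -> : ((p + Psi (s *: x)) / s + (p + Psi (t *: y)) / t) * r =
     p + (t / (s + t) * Psi (s *: x) + s / (s + t) * Psi (t *: y)).
    by rewrite /r; field; rewrite !gt_eqF.
  by rewrite lerD2l.
rewrite -ler_pdivrMl//; apply: polar_gauge_ge => s s0; rewrite ler_pdivrMl//.
apply: le_trans (polar_gauge_le _ p0 (divr_gt0 s0 t0)) _.
rewrite scalerA divfK ?gt_eqF//.
by have -> : (p + Psi (s *: x)) / (s / t) = t * ((p + Psi (s *: x)) / s)
  by field; rewrite !gt_eqF.
Qed.

(** A minorant of the gauge that is linear along the basis and agrees with it at [z] is [dotr] with
    some [y]. The choice [s = 1] in the infimum gives [dotr w y <= p + Psi w], that is, [y] lies in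
    the polar set. *)
Lemma polar_gauge_support p z : 0 < p ->
  exists2 y, A_set Psi p y & dotr z y = polar_gauge p z.
Proof.
move=> p0; have [phi [phis le_phi phiz phi_odd]] :=
  odd_minorant z [seq delta_mx 0 i | i <- enum 'I_n] (polar_gauge_sublinear p0).
pose y : 'rV[R]_n := \row_i phi (delta_mx 0 i).
have phiE w : phi w = dotr w y.
  rewrite [w in LHS]row_sum_delta odd_at_sum //.
    by apply: eq_bigr => i _; rewrite mxE.
  by move=> i; apply: phi_odd; rewrite inE map_f ?orbT// mem_enum.
exists y; last by rewrite -phiE.
apply/A_setP => w; rewrite dotrC -phiE.
have := le_trans (le_phi w) (polar_gauge_le w p0 ltr01).
by rewrite divr1 scale1r; lra.
Qed.

(** The gauge of [z] is at most [h < 2 h], so some [s] has [p + Psi (s *: z) < 2 h s]; the factor 2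
    supplies the strict inequality that a possibly unattained infimum requires. Then
    [p / (2 h) <= s], and (C5) transfers the bound down to [p / (2 h)]. *)
Lemma A_set_support p z h : 0 < p -> 0 < h ->
  (forall y, A_set Psi p y -> dotr z y <= h) -> Psi ((p / (2 * h)) *: z) <= p.
Proof.
move=> p0 h0 hz; have [y Ay yE] := polar_gauge_support z p0.
have {Ay yE} : polar_gauge p z < 2 * h by rewrite -yE; have := hz _ Ay; lra.
move=> /(@inf_lt _ _ _ _)[|_ [s /= s0 <-] lt_s].
  by exists ((p + Psi (1 *: z)) / 1), 1 => /=.
have h20 : 0 < 2 * h by lra.
set t := p / (2 * h); have t0 : 0 < t by rewrite divr_gt0.
have Psis := condition_C_ge0 PsiC (s *: z).
move: lt_s; rewrite ltr_pdivrMr// => lt_s.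
have ts : t <= s by rewrite ler_pdivrMr// mulrC; lra.
have := condition_C5 PsiC z t0 ts; rewrite ler_pdivrMr// => h1; apply: le_trans h1 _.
have -> : p = 2 * h * t by rewrite /t mulrC divfK// gt_eqF.
by rewrite ler_pM2r// ler_pdivrMr//; lra.
Qed.

End Polar.

(** * Expectations of bounded functions, and entropy against the second moment *)

Section Expectation.
Context {d : measure_display} {T : measurableType d} {R : realType}.
Implicit Types (f g : T -> R) (c r : R).

Definition bounded_measurable f :=
  measurable_fun [set: T] f /\ exists M : R, forall x, `|f x| <= M.

Lemma bm_cst c : bounded_measurable (fun=> c).
Proof. by split => //; exists `|c|. Qed.

Lemma bmD f g : bounded_measurable f -> bounded_measurable g ->
  bounded_measurable (fun x => f x + g x).
Proof.
move=> [mf [M fM]] [mg [N gN]]; split; first exact: measurable_funD.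
by exists (M + N) => x; apply: le_trans (ler_normD _ _) _; apply: lerD.
Qed.

Lemma bmM f g : bounded_measurable f -> bounded_measurable g ->
  bounded_measurable (fun x => f x * g x).
Proof.
move=> [mf [M fM]] [mg [N gN]]; split; first exact: measurable_funM.
by exists (M * N) => x; rewrite normrM ler_pM.
Qed.

Lemma bmX f k : bounded_measurable f -> bounded_measurable (fun x => f x ^+ k).
Proof.
move=> [mf [M fM]]; split; first exact: measurable_funX.
by exists (M ^+ k) => x; rewrite normrX lerXn2r ?nnegrE// (le_trans _ (fM x)).
Qed.

Lemma bm_powR f r : 0 <= r -> (forall x, 0 <= f x) -> bounded_measurable f ->
  bounded_measurable (fun x => f x `^ r).
Proof.
move=> r0 f0 [mf [M fM]]; split.
  exact: (measurableT_comp (measurable_powR r) mf).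
exists (M `^ r) => x; rewrite ger0_norm ?powR_ge0//.
have := fM x; rewrite ger0_norm// => fxM.
by rewrite ge0_ler_powR// nnegrE// (le_trans (f0 x)).
Qed.

Lemma bm_ln f : (forall x, 1 <= f x) -> bounded_measurable f ->
  bounded_measurable (fun x => ln (f x)).
Proof.
move=> f1 [mf [M fM]]; split; first by apply: measurableT_comp => //; apply: measurable_ln.
exists (ln M) => x; rewrite ger0_norm ?ln_ge0//.
have fx0 : 0 < f x by apply: lt_le_trans (f1 x).
have fxM := le_trans (ler_norm _) (fM x).
by rewrite ler_ln// posrE// (lt_le_trans fx0).
Qed.

Context (mu : probability T R).

Lemma bm_integrable f : bounded_measurable f -> mu.-integrable [set: T] (EFin \o f).
Proof.
move=> [mf [M fM]]; apply: measurable_bounded_integrable => //.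
  by rewrite -ge0_fin_numE// fin_num_measure.
by exists M; split; [exact: num_real | move=> N MN x _; apply: le_trans (fM x) (ltW MN)].
Qed.

Lemma expectation_cst c : \int[mu]_x c = c.
Proof. by rewrite Rintegral_cst// [X in fine X]probability_setT mulr1. Qed.

Lemma le_expectation f g : bounded_measurable f -> bounded_measurable g ->
  (forall x, f x <= g x) -> \int[mu]_x f x <= \int[mu]_x g x.
Proof. by move=> bf bg fg; apply: le_Rintegral => //; exact: bm_integrable. Qed.

Lemma expectationD f g : bounded_measurable f -> bounded_measurable g ->
  \int[mu]_x (f x + g x) = \int[mu]_x f x + \int[mu]_x g x.
Proof. by move=> bf bg; apply: RintegralD => //; exact: bm_integrable. Qed.

Lemma expectationZ c f : bounded_measurable f ->
  \int[mu]_x (c * f x) = c * \int[mu]_x f x.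
Proof. by move=> bf; apply: RintegralZl => //; exact: bm_integrable. Qed.

Lemma expectation_EFin f : mu.-integrable [set: T] (EFin \o f) ->
  (\int[mu]_x (f x)%:E)%E = (\int[mu]_x f x)%:E.
Proof. by move=> intf; rewrite /Rintegral fineK//; apply: integrable_fin_num. Qed.

(* The energy integrand of mLSI is not known to be measurable. *)
Lemma ge0_le_integralT (f g : T -> \bar R) : (forall x, 0 <= f x)%E ->
  (forall x, f x <= g x)%E -> (\int[mu]_x f x <= \int[mu]_x g x)%E.
Proof.
move=> f0 fg; have g0 x : (0 <= g x)%E by apply: le_trans (fg x).
rewrite !ge0_integralTE//; apply: le_ereal_sup => _ [h hf <-].
by exists h => // x; apply: le_trans (fg x).
Qed.

(* Under the density [f ^+ 2 / S] this is Jensen's inequality for [ln f]. *)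
Lemma second_moment_le_Ent f (e : R) : (forall x, 1 <= f x) -> bounded_measurable f ->
  (Ent mu (fun x => (f x ^+ 2)%R) <= (e * \int[mu]_x (f x ^+ 2))%:E)%E ->
  \int[mu]_x (f x ^+ 2) <= (\int[mu]_x f x) ^+ 2 * expR e.
Proof.
move=> f1 bf; set S := \int[mu]_x (f x ^+ 2).
have f0 x : 0 < f x by apply: lt_le_trans (f1 x).
have bf2 := bmX 2 bf; have bl := bmM bf2 (bm_ln f1 bf).
have S1 : 1 <= S.
  rewrite -(expectation_cst 1); apply: le_expectation => //; first exact: bm_cst.
  by move=> x; rewrite exprn_ege1.
have S0 : 0 < S by apply: lt_le_trans S1.
pose m := (\int[mu]_x (f x ^+ 2 * ln (f x))) / S.
have EntE : Ent mu (fun x => f x ^+ 2) = (2 * (m * S) - S * ln S)%:E.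
  rewrite /Ent; have -> : (fun x => (f x ^+ 2 * ln (f x ^+ 2))%:E) =
      EFin \o (fun x => 2 * (f x ^+ 2 * ln (f x))).
    by apply/funext => x /=; rewrite lnXn// mulr2n; congr EFin; ring.
  rewrite (expectation_EFin (bm_integrable (bmM (bm_cst 2) bl))).
  rewrite (expectation_EFin (bm_integrable bf2)) expectationZ// -/S lne_EFin//.
  by rewrite /m divfK ?gt_eqF.
rewrite EntE lee_fin => Ent_le.
have m_le : 2 * m <= e + ln S.
  have : S * (2 * m) <= S * (e + ln S) by rewrite mulrDr; lra.
  by rewrite ler_pM2l.
(* Integrate the tangent bound [1 + (m - ln f) <= expR (m - ln f)] against [f ^+ 2]; [m] is the mean
   of [ln f] under the density [f ^+ 2 / S], so the linear term cancels. *)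
have jensen : expR (- m) * S <= \int[mu]_x f x.
  have bh : bounded_measurable
      (fun x => (1 + m) * f x ^+ 2 + -1 * (f x ^+ 2 * ln (f x))).
    by apply: bmD; apply: bmM => //; apply: bm_cst.
  have -> : expR (- m) * S =
      \int[mu]_x (expR (- m) * ((1 + m) * f x ^+ 2 + -1 * (f x ^+ 2 * ln (f x)))).
    rewrite expectationZ// expectationD; try by apply: bmM => //; apply: bm_cst.
    rewrite !expectationZ// -/S; congr *%R.
    have -> : \int[mu]_x (f x ^+ 2 * ln (f x)) = m * S by rewrite divfK ?gt_eqF.
    by ring.
  apply: le_expectation => //; first by apply: bmM => //; apply: bm_cst.
  move=> x; have -> : (1 + m) * f x ^+ 2 + -1 * (f x ^+ 2 * ln (f x)) =
    f x * (f x * (1 + (m - ln (f x)))) by ring.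
  rewrite mulrCA ger_pMr// mulrCA -ler_pdivlMl// mulr1 expRN.
  rewrite ler_pdivrMl ?expR_gt0//; apply: le_trans (expR_ge1Dx _) _.
  by rewrite expRD expRN lnK ?posrE.
have -> : S = (expR (- m) * S) ^+ 2 * (expR (2 * m) / S).
  by rewrite expRN (mulrC 2) expRM_natr; field; rewrite !gt_eqF// expR_gt0.
apply: ler_pM.
- exact: sqr_ge0.
- by rewrite divr_ge0 ?expR_ge0// ltW.
- by rewrite lerXn2r// nnegrE ?(le_trans _ jensen)// mulr_ge0 ?expR_ge0// ltW.
- have eSE : expR e * S = expR (e + ln S) by rewrite expRD lnK ?posrE.
  by rewrite ler_pdivrMr// eSE ler_expR.
Qed.

End Expectation.

(** * Smooth locally Lipschitz functions with explicit differentials *)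

Section LocallyLipschitz.
Context {R : realType}.
Implicit Types (V : normedModType R).

(** Explicit radius and constant let the sum, product and composition rules compute theirs;
    [loc_lip_locally_lipschitz] returns to the notion used in [mLSI]. *)
Definition loc_lip V (f : V -> R) := forall x, exists e K : R, [/\ 0 < e, 0 <= K &
  forall y z, `|x - y| < e -> `|x - z| < e -> `|f y - f z| <= K * `|y - z|].

Lemma loc_lip_cst V (c : R) : loc_lip (fun _ : V => c).
Proof. by move=> x; exists 1, 0; split => // y z _ _; rewrite subrr normr0 mul0r. Qed.

Lemma loc_lipD V (f g : V -> R) : loc_lip f -> loc_lip g ->
  loc_lip (fun x => f x + g x).
Proof.
move=> hf hg x; have [e [K [e0 K0 fK]]] := hf x; have [e' [K' [e'0 K'0 gK]]] := hg x.
exists (Num.min e e'), (K + K'); split; [by rewrite lt_min e0|exact: addr_ge0|].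
move=> y z; rewrite !lt_min => /andP[xy xy'] /andP[xz xz'].
rewrite opprD addrACA mulrDl; apply: le_trans (ler_normD _ _) _.
by rewrite lerD ?fK ?gK.
Qed.

Lemma loc_lip_bounded V (f : V -> R) e K x y : 0 < e ->
  (forall y z, `|x - y| < e -> `|x - z| < e -> `|f y - f z| <= K * `|y - z|) ->
  0 <= K -> `|x - y| < e -> `|f y| <= `|f x| + K * e.
Proof.
move=> e0 fK K0 xy; have xx : `|x - x| < e by rewrite subrr normr0.
have := fK y x xy xx; rewrite [`|y - x|]distrC => h.
have := ler_normD (f x) (f y - f x); rewrite addrC subrK => h2.
have : K * `|x - y| <= K * e by rewrite ler_wpM2l// ltW.
by move: h h2; lra.
Qed.

Lemma loc_lipM V (f g : V -> R) : loc_lip f -> loc_lip g ->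
  loc_lip (fun x => f x * g x).
Proof.
move=> hf hg x; have [e [K [e0 K0 fK]]] := hf x; have [e' [K' [e'0 K'0 gK]]] := hg x.
exists (Num.min e e'), ((`|f x| + K * e) * K' + (`|g x| + K' * e') * K); split.
- by rewrite lt_min e0.
- by rewrite addr_ge0// mulr_ge0// addr_ge0// mulr_ge0// ltW.
move=> y z; rewrite !lt_min => /andP[xy xy'] /andP[xz xz'].
have -> : f y * g y - f z * g z = f y * (g y - g z) + g z * (f y - f z) by ring.
apply: le_trans (ler_normD _ _) _; rewrite !normrM mulrDl -!mulrA lerD//.
  by apply: ler_pM => //; [exact: loc_lip_bounded fK K0 xy | exact: gK].
by apply: ler_pM => //; [exact: loc_lip_bounded gK K'0 xz' | exact: fK].
Qed.

Lemma loc_lip_comp V (phi : R -> R) (f : V -> R) : loc_lip phi -> loc_lip f ->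
  loc_lip (fun x => phi (f x)).
Proof.
move=> hp hf x; have [e [K [e0 K0 fK]]] := hf x.
have [e' [K' [e'0 K'0 pK]]] := hp (f x).
have K1 : 0 < K + 1 by rewrite ltr_wpDl.
exists (Num.min e (e' / (K + 1))), (K' * K); split; last 1 first.
- move=> y z; rewrite !lt_min => /andP[xy xy'] /andP[xz xz'].
  have xx : `|x - x| < e by rewrite subrr normr0.
  have near_f w : `|x - w| < e -> `|x - w| < e' / (K + 1) -> `|f x - f w| < e'.
    move=> xw; rewrite ltr_pdivlMr// => h; apply: le_lt_trans (fK _ _ xx xw) _.
    by have := normr_ge0 (x - w); lra.
  apply: le_trans (pK _ _ (near_f _ xy xy') (near_f _ xz xz')) _.
  by rewrite -mulrA ler_wpM2l// fK.
- by rewrite lt_min e0 divr_gt0.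
- exact: mulr_ge0.
Qed.

Lemma C1_loc_lip (phi dphi : R -> R) : (forall t : R, is_derive t 1 phi (dphi t)) ->
  continuous dphi -> loc_lip phi.
Proof.
move=> dP cd t; have /cvgrPdist_lt /(_ 1 ltr01) := cd t.
move=> /nbhs_ballP[e /= e0 near_t]; exists e, (`|dphi t| + 1); split => //.
move=> y z; wlog yz : y z / (y : R) <= z => [main ty tz|ty tz].
  have [yz|zy] := orP (le_total (y : R) z); first exact (main y z yz ty tz).
  by rewrite distrC [`|y - z|]distrC; exact (main z y zy tz ty).
rewrite distrC [`|y - z|]distrC.
have cphi : {within `[(y : R), z], continuous phi}.
  by apply: derivable_within_continuous => x _; apply: ex_derive.
have [c] := MVT_segment yz (fun x _ => dP x) cphi.
rewrite in_itv/= => /andP[yc cz] ->; rewrite normrM ler_wpM2r//.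
have tc : `|t - c| < e.
  by move: ty tz; rewrite !ltr_norml => /andP[? ?] /andP[? ?]; apply/andP; split; lra.
have := near_t c tc => /= h.
have := ler_normD (dphi t) (dphi c - dphi t); rewrite addrC subrK distrC.
by move: h; lra.
Qed.

Lemma loc_lip_locally_lipschitz n (f : 'rV[R]_n -> R) : loc_lip f -> locally_lipschitz f.
Proof.
move=> hf x; have [e [K [e0 K0 fK]]] := hf x; exists (ball x e).
  exact: nbhsx_ballx.
exists K; split; first exact: num_real.
move=> M KM [y z] /= []; rewrite -!ball_normE /= => xy xz.
by apply: le_trans (fK _ _ xy xz) _; rewrite ler_wpM2r// ltW.
Qed.

End LocallyLipschitz.

Section Smooth.
Context {R : realType} {n : nat}.
Implicit Types (f g : 'rV[R]_n -> R) (df dg : 'rV[R]_n -> 'rV[R]_n -> R).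

(** The Lipschitz half is what [mLSI] asks of test functions. The differential is carried as a
    function, so that slope bounds along a set of directions can be stated directly. *)
Definition smooth f df := loc_lip f /\ forall x, is_diff x f (df x).

Lemma smooth_cst (c : R) : smooth (fun=> c) (fun _ _ => 0).
Proof. by split=> [|x]; [exact: loc_lip_cst | exact: is_diff_cst]. Qed.

Lemma smoothD f df g dg : smooth f df -> smooth g dg ->
  smooth (fun x => f x + g x) (fun x v => df x v + dg x v).
Proof.
by move=> [lf df_] [lg dg_]; split=> [|x]; [exact: loc_lipD | exact: is_diffD].
Qed.

Lemma smoothM f df g dg : smooth f df -> smooth g dg ->
  smooth (fun x => f x * g x) (fun x v => f x * dg x v + g x * df x v).
Proof.
by move=> [lf df_] [lg dg_]; split=> [|x]; [exact: loc_lipM | exact: is_diffM].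
Qed.

Lemma smooth_comp (phi dphi : R -> R) f df :
  (forall t : R, is_derive t 1 phi (dphi t)) -> continuous dphi -> smooth f df ->
  smooth (fun x => phi (f x)) (fun x v => dphi (f x) * df x v).
Proof.
move=> dP cd [lf df_]; split=> [|x].
  exact: loc_lip_comp (C1_loc_lip dP cd) lf.
have dphix : differentiable phi (f x) by apply/derivable1_diffP/ex_derive.
have dfx : differentiable f x by apply: ex_diff.
apply: DiffDef; first exact: differentiable_comp.
rewrite (diff_comp dfx dphix) diff_val diff1E// derive1E derive_val.
by apply/funext => v /=; rewrite /GRing.scale/= mulrC.
Qed.

Lemma smooth_coord i : smooth (fun x => x 0 i) (fun _ v => v 0 i).
Proof.
split=> x.
  exists 1, 1; split => // y z _ _; rewrite mul1r.
  have -> : y 0 i - z 0 i = (y - z) 0 i by rewrite !mxE.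
  by rewrite [leRHS]/Num.norm/= mx_normrE; apply/bigmax_geP; right; exists (0, i).
apply: DiffDef; first exact: differentiable_coord.
have @h : {linear 'rV[R]_n -> R}.
  by exists (fun x : 'rV[R]_n => x 0 i); do 2![eexists]; do ?[constructor];
     rewrite ?mxE// => ? *; rewrite ?mxE//; move=> ?; rewrite !mxE.
rewrite (_ : (fun x : 'rV[R]_n => x 0 i) = h) // diff_lin//; exact: coord_continuous.
Qed.

Lemma smooth_eq f g df dg : smooth f df -> f =1 g -> df =2 dg -> smooth g dg.
Proof.
move=> sf fg e; have -> : g = f by apply/funext.
by have -> : dg = df by apply/funext => x; apply/funext.
Qed.

Lemma smoothZ (c : R) f df : smooth f df ->
  smooth (fun x => c * f x) (fun x v => c * df x v).
Proof.
move=> sf; apply: smooth_eq (smoothM (smooth_cst c) sf) _ _ => // x v.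
by rewrite mulr0 addr0.
Qed.

Lemma smoothN f df : smooth f df -> smooth (fun x => - f x) (fun x v => - df x v).
Proof. by move=> sf; apply: smooth_eq (smoothZ (-1) sf) _ _ => x *; rewrite mulN1r. Qed.

Lemma smooth_sum (I : Type) (r : seq I) (f : I -> 'rV[R]_n -> R)
    (df : I -> 'rV[R]_n -> 'rV[R]_n -> R) :
  (forall i, smooth (f i) (df i)) ->
  smooth (fun x => \sum_(i <- r) f i x) (fun x v => \sum_(i <- r) df i x v).
Proof.
move=> sf; elim: r => [|i r IHr].
  by apply: smooth_eq (smooth_cst 0) _ _ => x *; rewrite big_nil.
by apply: smooth_eq (smoothD (sf i) IHr) _ _ => x *; rewrite big_cons.
Qed.

Lemma smooth_continuous f df : smooth f df -> continuous f.
Proof. by move=> [_ h] x; apply: differentiable_continuous; apply: ex_diff. Qed.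

Lemma smooth_derive f df x v : smooth f df -> 'D_v f x = df x v.
Proof.
move=> [_ /(_ x) h]; rewrite deriveE; last exact: ex_diff.
by rewrite diff_val.
Qed.

Lemma dotr_grad f df x v : smooth f df -> dotr (grad f x) v = df x v.
Proof.
move=> [_ /(_ x) h]; rewrite -[df x]diff_val [v in RHS]row_sum_delta linear_sum.
apply: eq_bigr => i _; rewrite mxE linearZ /= deriveE; last exact: ex_diff.
by rewrite mulrC.
Qed.

Lemma continuous_measurable_rV f : continuous f ->
  measurable_fun [set: borel_rV R n] (f : borel_rV R n -> R).
Proof.
move=> cf; apply: (measurability _ (RGenOInfty.measurableE R)) => //.
move=> _ [_ [x ->] <-]; apply: sub_sigma_algebra; rewrite setTI.
by apply: open_comp => [y _|]; [exact: cf | exact: interval_open].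
Qed.

End Smooth.

Section Softplus.
Context {R : realType}.
Implicit Types (s t : R).

(** A smooth positive part: between [max 0 t] and [max 0 t + 1], with slope [sigmoid t] in [[0, 1]].
    It builds both the test functions [v] and the smoothed maxima. *)
Definition softplus t := ln (1 + expR t).
Definition sigmoid t := expR t / (1 + expR t).

Lemma onep_expR_gt0 t : 0 < 1 + expR t.
Proof. by rewrite addr_gt0 ?expR_gt0. Qed.

Lemma sigmoid_ge0 t : 0 <= sigmoid t.
Proof. by rewrite divr_ge0 ?expR_ge0// ltW// onep_expR_gt0. Qed.

Lemma sigmoid_le1 t : sigmoid t <= 1.
Proof. by rewrite ler_pdivrMr ?onep_expR_gt0// mul1r lerDr. Qed.

Lemma is_derive_softplus t : is_derive t 1 softplus (sigmoid t).
Proof.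
have h : is_derive t 1 (fun s => 1 + expR s) (expR t).
  by have := is_deriveD (is_derive_cst (1 : R) t 1) (is_derive_expR t); rewrite add0r.
have := is_derive1_comp (f := @ln R) (g := fun s => 1 + expR s) (is_derive1_ln (onep_expR_gt0 t)) h.
by rewrite mulrC.
Qed.

Lemma continuous_sigmoid : continuous sigmoid.
Proof.
move=> t; apply: cvgM; first exact: continuous_expR.
apply: cvgV; first by rewrite gt_eqF// onep_expR_gt0.
by apply: cvgD; [exact: cvg_cst | exact: continuous_expR].
Qed.

Lemma softplus_ge0 t : 0 <= softplus t.
Proof. by rewrite ln_ge0// lerDl expR_ge0. Qed.

Lemma softplus_ge t : t <= softplus t.
Proof. by rewrite -[leLHS]expRK ler_ln ?posrE ?expR_gt0 ?onep_expR_gt0// lerDr. Qed.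

Lemma softplus_le1 t : t <= 0 -> softplus t <= 1.
Proof.
move=> t0; rewrite -[leRHS]expRK ler_ln ?posrE ?expR_gt0 ?onep_expR_gt0//.
have : expR t <= 1 by rewrite -expR0 ler_expR.
by have := expR_ge1Dx (1 : R); lra.
Qed.

Lemma softplus_le t : softplus t <= Num.max 0 t + 1.
Proof.
have [t0|t0] := lerP t 0; first by rewrite add0r softplus_le1.
have -> : softplus t = t + softplus (- t).
  have pN := onep_expR_gt0 (- t).
  have -> : t + softplus (- t) = ln (expR t * (1 + expR (- t))).
    by rewrite lnM ?posrE ?expR_gt0// expRK.
  by rewrite mulrDr mulr1 -expRD subrr expR0 addrC.
by rewrite lerD2l softplus_le1// oppr_le0 ltW.
Qed.

Lemma softplus_gt0 t : 0 < 1 + softplus t.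
Proof. by rewrite ltr_pwDl ?softplus_ge0. Qed.

Lemma is_derive_softplus_powR s t :
  is_derive t 1 (fun u => (1 + softplus u) `^ s)
    (s * (1 + softplus t) `^ (s - 1) * sigmoid t).
Proof.
have h : is_derive t 1 (fun u => 1 + softplus u) (sigmoid t).
  by have := is_deriveD (is_derive_cst (1 : R) t 1) (is_derive_softplus t); rewrite add0r.
exact (is_derive1_comp (f := fun y : R => y `^ s) (g := fun u => 1 + softplus u)
  (is_derive1_powR s (softplus_gt0 t)) h).
Qed.

Lemma continuous_softplus_powR' s :
  continuous (fun t => s * (1 + softplus t) `^ (s - 1) * sigmoid t).
Proof.
move=> t; apply: cvgM; last exact: continuous_sigmoid.
apply: cvgM; first exact: cvg_cst.
apply: (differentiable_continuous (f := fun u => (1 + softplus u) `^ (s - 1))).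
by have [? _] := is_derive_softplus_powR (s - 1) t; exact/derivable1_diffP.
Qed.

End Softplus.

(** Where [H <= v] the ratio contributes at most 1. Elsewhere raising the exponent [c] to [r] only
    increases it, and [v] cancels. *)
Lemma powR_ratio_le (R : realType) (H v c r : R) : 0 <= H -> 0 < v -> 0 <= c -> c <= r ->
  (H / v) `^ c * v `^ r <= H `^ r + v `^ r.
Proof.
move=> H0 v0 c0 cr; have r0 : 0 <= r by apply: le_trans cr.
have Hv0 : 0 <= H / v := divr_ge0 H0 (ltW v0).
have [Hv|vH] := lerP (H / v) 1.
  apply: (@le_trans _ _ (v `^ r)); last by rewrite lerDr powR_ge0.
  have one : 1 `^ c = 1 :> R by rewrite powR1.
  by rewrite ler_piMl ?powR_ge0// -[leRHS]one ge0_ler_powR// nnegrE.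
apply: (@le_trans _ _ (H `^ r)); last by rewrite lerDl powR_ge0.
apply: (@le_trans _ _ ((H / v) `^ r * v `^ r)).
  by rewrite ler_wpM2r ?powR_ge0// ler_powR// ltW.
by rewrite -powRM ?(ltW v0)// divfK// gt_eqF.
Qed.

(** For [l < 1] the growth condition is read backwards, from [l *: x] to [x] with factor [l^-1]: its
    lower half then gives the power [alpha]. *)
Lemma growth_le (R : realType) (n : nat) (K alpha beta l : R) (Psi : 'rV[R]_n -> R) x :
  condition_C Psi -> growth K alpha beta Psi -> 1 <= K -> 0 <= l ->
  Psi (l *: x) <= K * (l `^ alpha + l `^ beta) * Psi x.
Proof.
move=> PsiC PsiG K1 l0; have K0 : 0 < K by lra.
have rhs0 y : 0 <= K * (l `^ alpha + l `^ beta) * Psi y.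
  apply: mulr_ge0; last exact: condition_C_ge0.
  by rewrite mulr_ge0 ?addr_ge0 ?powR_ge0// ltW.
have [->|x0] := eqVneq x 0; first by rewrite scaler0 (condition_C1 PsiC).1 mulr0.
have Px := condition_C2 PsiC x0.
have [l1|l1] := lerP 1 l.
  have /andP[_] := PsiG x l x0 l1; rewrite ler_pdivrMr// => h; apply: le_trans h _.
  by rewrite ler_pM2r// ler_pM2l// lerDr powR_ge0.
have [l_eq0|lne0] := eqVneq l 0.
  by rewrite [in leLHS]l_eq0 scale0r (condition_C1 PsiC).1.
have lp : 0 < l by rewrite lt_def lne0.
have lx0 : l *: x != 0 by rewrite scaler_eq0 negb_or lne0.
have Plx := condition_C2 PsiC lx0.
have l1' : 1 <= l^-1 by rewrite invf_ge1// ltW.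
have /andP[+ _] := PsiG _ _ lx0 l1'; rewrite scalerA mulVf// scale1r ler_pdivlMr//.
have la : l `^ alpha * l^-1 `^ alpha = 1.
  by rewrite -powRM ?invr_ge0// mulfV// powR1.
have Kla : 0 < K * l `^ alpha by rewrite mulr_gt0 ?powR_gt0.
rewrite -(ler_pM2l Kla) => h; apply: le_trans (le_trans _ h) _.
  have -> : K * l `^ alpha * (K^-1 * l^-1 `^ alpha * Psi (l *: x)) =
    (K * K^-1) * (l `^ alpha * l^-1 `^ alpha) * Psi (l *: x) by ring.
  by rewrite la mulfV ?gt_eqF// !mul1r.
rewrite ler_pM2r// ler_pM2l// lerDl powR_ge0//.
Qed.

(** Induction on the number of halvings that bring [r] below [2 * beta]. The hypothesis on [M r]
    keeps the correction in the form [r * (r / p) ^ (alpha - 1)], so at [r = p] only a constant to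
    the power [p] remains. *)
Lemma moment_doubling (R : realType) (M : R -> R) (alpha beta p B c : R) :
  1 < alpha -> 0 < beta -> beta <= p -> 1 <= B -> 0 <= c ->
  (forall r, 0 <= M r) ->
  (forall r, beta <= r -> r <= p -> r < 2 * beta -> M r <= B `^ r) ->
  (forall r, beta <= r -> r <= p ->
    M r <= M (r / 2) ^+ 2 * expR (c * (r * (r / p) `^ (alpha - 1)))) ->
  M p <= (B * expR (c / (1 - 2^-1 `^ (alpha - 1)))) `^ p.
Proof.
move=> a1 b0 bp B1 c0 M0 Mbase Mstep; have p0 : 0 < p by lra.
set th := 2^-1 `^ (alpha - 1).
have th0 : 0 < th by rewrite powR_gt0.
have th1 : th < 1.
  have := @gt0_ltr_powR R (alpha - 1) _ 2^-1 1; rewrite powR1; apply; rewrite ?nnegrE; lra.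
(* Sum of the geometric series [c * th ^ i], equivalently the solution of [c' * th + c = c']; this
   equation makes the induction reproduce its own bound. *)
set c' := c / (1 - th).
have c'0 : 0 <= c' by rewrite divr_ge0// subr_ge0 ltW.
have cE : c' * th + c = c' by rewrite /c'; field; lra.
have main m r : beta <= r -> r <= p -> r < 2 ^+ m * (2 * beta) ->
    M r <= B `^ r * expR (c' * (r * (r / p) `^ (alpha - 1))).
  elim: m r => [|m IHm] r br rp rm.
    apply: le_trans (Mbase r br rp _) _; first by move: rm; rewrite expr0 mul1r.
    rewrite ler_peMr ?powR_ge0// -expR0 ler_expR mulr_ge0// mulr_ge0 ?powR_ge0//; lra.
  have [rb|rb] := ltrP r (2 * beta).
    apply: le_trans (Mbase r br rp rb) _.
    rewrite ler_peMr ?powR_ge0// -expR0 ler_expR mulr_ge0// mulr_ge0 ?powR_ge0//; lra.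
  have h1 : beta <= r / 2 by lra.
  have h2 : r / 2 <= p by lra.
  have h3 : r / 2 < 2 ^+ m * (2 * beta) by move: rm; rewrite exprS; lra.
  apply: le_trans (Mstep r br rp) _.
  have := IHm _ h1 h2 h3.
  have -> : (r / 2 / p) `^ (alpha - 1) = (r / p) `^ (alpha - 1) * th.
    have -> : r / 2 / p = r / p * 2^-1 by ring.
    by rewrite powRM// divr_ge0//; lra.
  set q := (r / p) `^ (alpha - 1) => IH.
  have Mr0 := M0 (r / 2).
  apply: (@le_trans _ _ ((B `^ (r / 2) * expR (c' * (r / 2 * (q * th)))) ^+ 2 *
      expR (c * (r * q)))).
    by rewrite ler_wpM2r ?expR_ge0// lerXn2r// nnegrE// (le_trans Mr0).
  have B2 : (B `^ (r / 2)) ^+ 2 = B `^ r.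
    by rewrite -powR_mulrn ?powR_ge0// -powRrM divfK ?pnatr_eq0.
  rewrite exprMn B2 -expRM_natr -[leLHS]mulrA -expRD le_eqVlt; apply/orP; left; apply/eqP.
  by congr (_ * expR _); rewrite -[in RHS]cE; field.
have pm := upper_nthrootP (leqnn (Num.bound (p / (2 * beta)))).
apply: le_trans (main _ p bp (lexx p) _) _.
  by rewrite -ltr_pdivrMr//; [exact: pm | lra].
rewrite divff ?gt_eqF// powR1 mulr1 powRM ?expR_ge0//; last by lra.
by rewrite expRM.
Qed.

(** * Moments of [v] from the modified log-Sobolev inequality *)

Section Core.
Context {R : realType} {n : nat} {Psi : 'rV[R]_n -> R}.
Context {alpha beta K D : R} {mu : probability (borel_rV R n) R}.
Hypotheses (a1 : 1 < alpha) (ab : alpha <= beta) (b2 : 2 <= beta) (K1 : 1 <= K) (D0 : 0 < D).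
Hypothesis PsiC : condition_C Psi.
Hypothesis Psi_convex : @convex_function R 'rV[R]_n [set: 'rV[R]_n] Psi.
Hypothesis PsiG : growth K alpha beta Psi.
Hypothesis mu_mLSI : mLSI mu Psi D.

Context {p L : R} {g : 'rV[R]_n -> R} {dg : 'rV[R]_n -> 'rV[R]_n -> R} {H : 'rV[R]_n -> R}.
Hypotheses (bp : beta <= p) (L1 : 1 <= L) (Lbig : 120 * D * K * beta <= L).
Hypothesis sg : smooth g dg.
Hypothesis g_bounded : exists M : R, forall x, `|g x| <= M.
Hypothesis H0 : forall x, 0 < H x.
Hypothesis mH : measurable_fun [set: borel_rV R n] (H : borel_rV R n -> R).
Hypothesis dg_le : forall x y, A_set Psi p y -> dg x y <= H x / L.

(** The added 1 gives [v >= 1]: all powers are admissible test functions and division by [v] in the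
    logarithmic gradient is harmless. *)
Let v (x : borel_rV R n) : R := 1 + softplus (g x).

Let p0 : 0 < p. Proof. by move: b2 bp; lra. Qed.
Let L0 : 0 < L. Proof. by move: L1; lra. Qed.

Let v1 x : 1 <= v x. Proof. by rewrite lerDl softplus_ge0. Qed.
Let v0 x : 0 < v x. Proof. by apply: lt_le_trans (v1 x). Qed.

Let mv : measurable_fun [set: borel_rV R n] v.
Proof.
apply: continuous_measurable_rV; apply: smooth_continuous.
apply: smoothD; first exact: smooth_cst.
exact: smooth_comp is_derive_softplus continuous_sigmoid sg.
Qed.

Let bm_v : bounded_measurable v.
Proof.
split; first exact: mv.
have [M gM] := g_bounded; exists (1 + (M + 1)) => x; rewrite ger0_norm ?(ltW (v0 x))//.
rewrite lerD2l; apply: le_trans (softplus_le _) _; rewrite lerD2r ge_max.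
by rewrite (le_trans _ (gM x))//= (le_trans (ler_norm _) (gM x)).
Qed.

Let powv_ge1 r x : 0 <= r -> 1 <= v x `^ r.
Proof. by move=> r0; have := ler_powR (v1 x) r0; rewrite powRr0. Qed.

Let bm_powv r : 0 <= r -> bounded_measurable (fun x => v x `^ r).
Proof. by move=> r0; apply: bm_powR => // x; rewrite ltW. Qed.

Let powv_half r x : (v x `^ (r / 2)) ^+ 2 = v x `^ r.
Proof. by rewrite -powR_mulrn ?powR_ge0// -powRrM divfK ?pnatr_eq0. Qed.

Let smooth_powv r : smooth (fun x => v x `^ (r / 2))
  (fun x y => r / 2 * v x `^ (r / 2 - 1) * sigmoid (g x) * dg x y).
Proof.
exact: smooth_comp (is_derive_softplus_powR (r / 2))
  (@continuous_softplus_powR' R (r / 2)) sg.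
Qed.

Let log_grad r x : (v x `^ (r / 2))^-1 *: grad (fun x => v x `^ (r / 2)) x =
  (r / 2 * sigmoid (g x) / v x) *: grad g x.
Proof.
apply/rowP => i; rewrite !mxE.
rewrite (smooth_derive x _ (smooth_powv r)) (smooth_derive x _ sg).
have -> : v x `^ (r / 2 - 1) = v x `^ (r / 2) / v x.
  by rewrite powRB ?(gt_eqF (v0 x)) ?implybT// powRr1// ltW.
by field; rewrite !gt_eqF// powR_gt0.
Qed.

(** The summand 1 is there because [H ^ r <= 1 + H ^ p]: only the [p]-th moment of [H] is
    controlled. *)
Let W r x : R := H x `^ p + (1 + v x `^ r).
(** Duality gives [Psi z <= p], and the logarithmic gradient is [l *: z] with [l] the product of
    [sigmoid (g x)], [(r / p) / L] and [H x / v x]. Growth costs [l ^ alpha + l ^ beta]; the ratio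
    is absorbed into [W] by [powR_ratio_le]. *)
Let energy_le r x : beta <= r -> r <= p ->
  Psi ((v x `^ (r / 2))^-1 *: grad (fun x => v x `^ (r / 2)) x) * (v x `^ (r / 2)) ^+ 2
  <= 2 * K / L * (r * (r / p) `^ (alpha - 1)) * W r x.
Proof.
move=> br rp; have r0 : 0 < r by move: br b2; lra.
rewrite powv_half log_grad; set s := sigmoid (g x).
have s0 : 0 <= s := sigmoid_ge0 _; have s1 : s <= 1 := sigmoid_le1 _.
have Hx := H0 x; have vx := v0 x.
pose h := H x / L; have h0 : 0 < h by rewrite divr_gt0.
have grad_le y : A_set Psi p y -> dotr (grad g x) y <= h.
  by move=> Ay; rewrite (dotr_grad x y sg); apply: dg_le.
have := A_set_support PsiC Psi_convex p0 h0 grad_le.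
set z := (p / (2 * h)) *: grad g x => Psi_z.
pose rho := r / p / L; pose l := s * rho * (H x / v x).
have -> : (r / 2 * s / v x) *: grad g x = l *: z.
  rewrite /z scalerA; congr (_ *: _); rewrite /l /rho /h.
  by field; rewrite !gt_eqF.
have rho0 : 0 <= rho := divr_ge0 (divr_ge0 (ltW r0) (ltW p0)) (ltW L0).
have rp1 : r / p <= 1 by rewrite ler_pdivrMr// mul1r.
have rho1 : rho <= 1.
  by rewrite ler_pdivrMr// mul1r (le_trans rp1).
have Hv0 : 0 <= H x / v x := divr_ge0 (ltW Hx) (ltW vx).
have l0 : 0 <= l := mulr_ge0 (mulr_ge0 s0 rho0) Hv0.
(* Since [L >= 1] and [alpha > 1], [L ^ (- alpha) <= 1 / L]; this single factor [1 / L] later makes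
   the rate small. *)
have rhoE : rho `^ alpha <= r / p * (r / p) `^ (alpha - 1) / L.
  rewrite mulr_powRB1 ?divr_ge0 ?(ltW r0) ?(ltW p0)//; last by move: a1; lra.
  rewrite /rho powRM ?divr_ge0 ?invr_ge0 ?(ltW r0) ?(ltW p0) ?(ltW L0)//.
  rewrite ler_wpM2l ?powR_ge0//; apply: ge1r_powR; last exact: ltW.
  by rewrite invr_gt0 L0 invf_le1.
have l_le c : alpha <= c -> c <= beta -> l `^ c * v x `^ r <= rho `^ alpha * W r x.
  move=> ac cb; have c0 : 0 <= c by move: a1; lra.
  have -> : l `^ c = s `^ c * rho `^ c * (H x / v x) `^ c.
    by rewrite /l powRM ?(mulr_ge0 s0 rho0)// powRM.
  have sc : s `^ c <= 1.
    by have := @ge0_ler_powR R c c0 s 1; rewrite powR1 !nnegrE; apply.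
  have rc : rho `^ c <= rho `^ alpha.
    have [->|rho_neq0] := eqVneq rho 0.
      by rewrite !powR0//; move: a1; lra.
    by apply: ger_powR => //; rewrite rho1 andbT lt_def rho_neq0.
  have HrW : (H x / v x) `^ c * v x `^ r <= W r x.
    apply: le_trans (powR_ratio_le (ltW Hx) vx c0 (le_trans cb br)) _.
    rewrite /W addrA lerD2r.
    have [H1|H1] := lerP (H x) 1.
      apply: (@le_trans _ _ 1); last by rewrite lerDr powR_ge0.
      by have := @ge0_ler_powR R r (ltW r0) (H x) 1; rewrite powR1 !nnegrE ltW//; apply.
    by rewrite ler_wpDr// ler_powR// ltW.
  rewrite -mulrA; apply: ler_pM => //; rewrite ?mulr_ge0 ?powR_ge0//.
  by apply: le_trans rc; rewrite ler_piMl ?powR_ge0.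
have W0 : 0 <= W r x by rewrite /W !addr_ge0 ?powR_ge0.
have l1 := l_le alpha (lexx _) ab; have l2 := l_le beta ab (lexx _).
have K0 : 0 <= K by move: K1; lra.
apply: (@le_trans _ _ (K * (l `^ alpha + l `^ beta) * p * v x `^ r)).
  rewrite ler_wpM2r ?powR_ge0//; apply: le_trans (growth_le _ PsiC PsiG K1 l0) _.
  by rewrite ler_wpM2l// mulr_ge0// addr_ge0 ?powR_ge0.
apply: (@le_trans _ _ (2 * K * p * (rho `^ alpha * W r x))).
  have -> : K * (l `^ alpha + l `^ beta) * p * v x `^ r =
    K * p * (l `^ alpha * v x `^ r + l `^ beta * v x `^ r) by ring.
  have -> : 2 * K * p * (rho `^ alpha * W r x) =
    K * p * (rho `^ alpha * W r x + rho `^ alpha * W r x) by ring.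
  by rewrite ler_wpM2l ?lerD// mulr_ge0// ltW.
apply: (@le_trans _ _ (2 * K * p * (r / p * (r / p) `^ (alpha - 1) / L * W r x))).
  rewrite ler_wpM2l ?ler_wpM2r//.
  by rewrite !mulr_ge0// ltW.
by rewrite le_eqVlt; apply/orP; left; apply/eqP; field; rewrite !gt_eqF.
Qed.

Hypothesis H_moment : (\int[mu]_x (H x `^ p)%:E <= 1)%E.
Hypothesis g_median : (mu [set x : borel_rV R n | (0 < g x)%R] <= (2^-1)%:E)%E.

Let mom r : R := \int[mu]_x (v x `^ r).

Let mom_ge1 r : 0 <= r -> 1 <= mom r.
Proof.
move=> r0; rewrite -(expectation_cst mu 1); apply: le_expectation; first exact: bm_cst.
  exact: bm_powv.
by move=> x; apply: powv_ge1.
Qed.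

Let integral_W r : 0 <= r -> (\int[mu]_x (W r x)%:E <= (3 * mom r)%:E)%E.
Proof.
move=> r0; have bm1v : bounded_measurable (fun x => 1 + v x `^ r).
  by apply: bmD; [exact: bm_cst | exact: bm_powv].
have mHp : measurable_fun setT (fun x : borel_rV R n => (H x `^ p)%:E).
  by apply/measurable_EFinP; apply: measurableT_comp (measurable_powR p) mH.
under eq_integral do rewrite EFinD.
rewrite ge0_integralD//; last first.
- by apply/measurable_EFinP; case: bm1v.
- by move=> x _; rewrite lee_fin addr_ge0 ?powR_ge0.
- by move=> x _; rewrite lee_fin powR_ge0.
rewrite (expectation_EFin (bm_integrable mu bm1v)).
rewrite expectationD; [|exact: bm_cst|exact: bm_powv].
rewrite expectation_cst -/(mom r).
apply: (@le_trans _ _ (1 + (1 + mom r)%:E)%E); first by rewrite leeD2r.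
by rewrite -EFinD lee_fin; have := mom_ge1 r0; lra.
Qed.

(** Test function [v ^ (r / 2)]. The constant 6 is the 2 of [energy_le] times the 3 of
    [integral_W]. *)
Let mom_step r : beta <= r -> r <= p ->
  mom r <= mom (r / 2) ^+ 2 * expR (6 * D * K / L * (r * (r / p) `^ (alpha - 1))).
Proof.
move=> br rp; have r0 : 0 < r by move: br b2; lra.
have r20 : 0 <= r / 2 by lra.
set q := r * (r / p) `^ (alpha - 1).
have q0 : 0 <= q by rewrite mulr_ge0 ?powR_ge0// ltW.
have bf := bm_powv r20.
have momE : mom r = \int[mu]_x ((v x `^ (r / 2)) ^+ 2).
  by congr Rintegral; apply/funext => x; rewrite powv_half.
rewrite {1}momE; apply: second_moment_le_Ent => //.
  by move=> x; apply: powv_ge1.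
rewrite -momE.
have fpos x : 0 < v x `^ (r / 2) by rewrite powR_gt0.
have fbnd : [bounded (v x `^ (r / 2) : R) | x in [set: 'rV[R]_n]].
  case: bf => _ [M fM]; exists M; split; first exact: num_real.
  by move=> N MN x _; apply: le_trans (fM x) (ltW MN).
have flip : locally_lipschitz (fun x : 'rV[R]_n => v x `^ (r / 2)).
  exact: loc_lip_locally_lipschitz (smooth_powv r).1.
apply: le_trans (mu_mLSI fpos fbnd flip) _.
have K0 : 0 <= K by move: K1; lra.
set c := 2 * K / L * q.
have c0 : 0 <= c by rewrite mulr_ge0// divr_ge0 ?(ltW L0)// mulr_ge0.
have -> : 6 * D * K / L * q * mom r = D * (c * (3 * mom r)) by rewrite /c; ring.
rewrite EFinM lee_pmul2l//.
apply: (@le_trans _ _ (\int[mu]_x (c%:E * (W r x)%:E))%E).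
  apply: ge0_le_integralT => x; last by rewrite -EFinM lee_fin; apply: energy_le.
  by rewrite lee_fin mulr_ge0 ?sqr_ge0//; apply: condition_C_ge0.
rewrite ge0_integralZl_EFin//.
- by rewrite [leRHS]EFinM lee_wpmul2l ?lee_fin//; apply: integral_W; exact: ltW.
- by move=> x _; rewrite lee_fin /W !addr_ge0 ?powR_ge0.
- apply/measurable_EFinP; apply: measurable_funD.
    by apply: measurableT_comp (measurable_powR p) mH.
  by apply: measurable_funD => //; case: (bm_powv (ltW r0)).
Qed.

(** Here [120 = 6 * 2 * 10]: with [r < 2 * beta] the exponent is at most 1/10, and
    [expR (- 1/10) >= 9/10]. *)
Let half_small r : beta <= r -> r <= p -> r < 2 * beta ->
  expR (6 * D * K / L * (r * (r / p) `^ (alpha - 1))) <= 10 / 9.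
Proof.
move=> br rp rb; have r0 : 0 < r by move: br b2; lra.
have q1 : (r / p) `^ (alpha - 1) <= 1.
  have := @ge0_ler_powR R (alpha - 1) _ (r / p) 1; rewrite powR1 !nnegrE; apply => //.
  - by move: a1; lra.
  - by rewrite divr_ge0// ltW.
  - by rewrite ler_pdivrMr// mul1r.
have rq : r * (r / p) `^ (alpha - 1) <= 2 * beta.
  by apply: le_trans (ltW rb); rewrite ler_piMr// ltW.
have DKL0 : 0 <= 6 * D * K / L.
  by rewrite divr_ge0 ?(ltW L0)// !mulr_ge0 ?(ltW D0)//; move: K1; lra.
have e10 : 6 * D * K / L * (r * (r / p) `^ (alpha - 1)) <= 10^-1.
  apply: le_trans (ler_wpM2l DKL0 rq) _.
  have -> : 6 * D * K / L * (2 * beta) = 10^-1 * (120 * D * K * beta / L) by field; rewrite gt_eqF.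
  by rewrite ger_pMr ?invr_gt0// ler_pdivrMr// mul1r.
apply: (@le_trans _ _ (expR 10^-1)); first by rewrite ler_expR.
have := expR_ge1Dx (- 10^-1 : R); rewrite expRN => h.
have -> : (10 / 9 : R) = (9 / 10)^-1 by rewrite invf_div.
rewrite -[leLHS]invrK lef_pV2 ?posrE ?invr_gt0 ?expR_gt0//.
by move: h; lra.
Qed.

(* On [g > 0], which has mass at most 1/2, the mean of [f = v ^ (r / 2)] is
   controlled by its second moment; elsewhere [f <= 2 ^ (r / 2)]. *)
Let mom_base r : beta <= r -> r <= p -> r < 2 * beta -> mom r <= 10 `^ r.
Proof.
move=> br rp rb; have r0 : 0 < r by move: br b2; lra.
have r20 : 0 <= r / 2 by lra.
have S1 := mom_ge1 (ltW r0); set S := mom r in S1 *.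
have S0 : 0 < S by lra.
set A : R := 2 `^ (r / 2); have A0 : 0 < A by rewrite powR_gt0.
pose q := Num.sqrt S; have q0 : 0 < q by rewrite sqrtr_gt0.
have qq : q ^+ 2 = S by rewrite sqr_sqrtr// ltW.
pose G := [set x : borel_rV R n | 0 < g x].
have mG : measurable G.
  apply: sub_sigma_algebra; have -> : G = g @^-1` `]0, +oo[%classic.
    by apply/seteqP; split=> x /=; rewrite in_itv/= andbT.
  apply: open_comp; last exact: interval_open.
  by move=> x _; apply: smooth_continuous sg x.
have muG : \int[mu]_x (\1_G x) <= 2^-1.
  by rewrite /Rintegral integral_indic// setIT -lee_fin fineK ?fin_num_measure.
have bmG : bounded_measurable (\1_G : borel_rV R n -> R).
  split; first exact: measurable_indic.
  by exists 1 => x; rewrite indicE; case: (_ \in _); rewrite ?normr1 ?normr0.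
(* Free parameter in [f <= t / 2 * f ^+ 2 + 1 / (2 t)]. With mass 1/2 the best [t] is
   [1 / (sqrt 2 * q)]; 7/10 is a rational substitute, and 99/140 below approximates [1 / sqrt 2]. *)
pose t := 7 / (10 * q); have t0 : 0 < t by rewrite divr_gt0// mulr_gt0.
have half_le : mom (r / 2) <= A + (t / 2 * S + (2 * t)^-1 * 2^-1).
  apply: (@le_trans _ _ (\int[mu]_x (A + (t / 2 * v x `^ r + (2 * t)^-1 * \1_G x)))).
    apply: le_expectation; first exact: bm_powv.
      apply: bmD; first exact: bm_cst.
      by apply: bmD; apply: bmM => //; try exact: bm_cst; apply: bm_powv; apply: ltW.
    move=> x; rewrite -(powv_half r x); set f := v x `^ (r / 2).
    have f0 : 0 <= f by rewrite powR_ge0.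
    rewrite indicE; have [xG|xG] := boolP (x \in G) => /=.
      rewrite mulr1 ler_wpDl ?(ltW A0)//.
      have : 0 <= (t * f - 1) ^+ 2 / (2 * t) by rewrite divr_ge0 ?sqr_ge0// mulr_ge0// ltW.
      have -> : (t * f - 1) ^+ 2 / (2 * t) = t / 2 * f ^+ 2 + (2 * t)^-1 - f.
        by field; rewrite gt_eqF.
      by lra.
    have t20 : 0 <= t / 2 by lra.
    rewrite mulr0 addr0 ler_wpDr ?(mulr_ge0 t20) ?sqr_ge0//.
    rewrite /f /A ge0_ler_powR// ?nnegrE ?(ltW (v0 x))//.
    have : softplus (g x) <= 1.
      apply: softplus_le1; rewrite leNgt; apply: contra xG => gx.
      by rewrite inE.
    by rewrite /v; lra.
  rewrite expectationD; [|exact: bm_cst|].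
    rewrite expectation_cst lerD2l expectationD; last 2 first.
    - by apply: bmM; [exact: bm_cst | apply: bm_powv; exact: ltW].
    - by apply: bmM; first exact: bm_cst.
    rewrite !expectationZ//; last by apply: bm_powv; exact: ltW.
    by rewrite lerD2l ler_wpM2l// invr_ge0 mulr_ge0// ltW.
  apply: bmD; apply: bmM => //; try exact: bm_cst.
  by apply: bm_powv; exact: ltW.
have tE : t / 2 * S + (2 * t)^-1 * 2^-1 = 99 / 140 * q.
  by rewrite -qq /t; field; rewrite gt_eqF.
rewrite tE in half_le.
have S_le : q ^+ 2 <= (A + 99 / 140 * q) ^+ 2 * (10 / 9).
  rewrite qq; apply: le_trans (mom_step br rp) _; apply: ler_pM; rewrite ?expR_ge0//.
  - exact: sqr_ge0.
  - rewrite lerXn2r ?nnegrE//; first by have := mom_ge1 r20; lra.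
    by rewrite addr_ge0 ?mulr_ge0// ?(ltW A0)// ltW.
  - exact: half_small.
(* Otherwise [A < 28/140 * q], and [(127/140) ^ 2 * 10/9 < 1] contradicts [S_le]. *)
have qA : q <= 5 * A.
  rewrite leNgt; apply/negP => qA.
  have : A + 99 / 140 * q <= 127 / 140 * q by lra.
  move=> h; have : (A + 99 / 140 * q) ^+ 2 <= (127 / 140 * q) ^+ 2.
    by rewrite lerXn2r ?nnegrE ?addr_ge0 ?mulr_ge0// ?(ltW A0)// ltW.
  rewrite exprMn => h2; have q20 : 0 < q ^+ 2 by rewrite exprn_gt0.
  by move: S_le h2 q20; set Q := q ^+ 2; set B := (A + _) ^+ 2; lra.
rewrite -qq; apply: (@le_trans _ _ ((5 * A) ^+ 2)).
  by rewrite lerXn2r ?nnegrE ?mulr_ge0// ltW.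
(* [A ^+ 2 = 2 ^ r], and [5 ^ 2 <= 5 ^ r] because [r >= beta >= 2]. *)
have -> : (10 : R) = 5 * 2 by ring.
rewrite exprMn -(powR_mulrn 2 (ltW A0)) -powRrM divfK ?pnatr_eq0//.
rewrite powRM// -(@powR_mulrn _ 5 2)// ler_wpM2r ?powR_ge0// ler_powR//; first by lra.
by move: br b2; lra.
Qed.

(* Since [1 + softplus t >= t^+], this bounds the [p]-th moment of [g^+]. *)
Lemma self_normalized_moment :
  \int[mu]_x ((1 + softplus (g x)) `^ p) <= (10 * expR ((1 - 2^-1 `^ (alpha - 1))^-1)) `^ p.
Proof.
have th1 : 2^-1 `^ (alpha - 1) < 1 :> R.
  by have := @gt0_ltr_powR R (alpha - 1) _ 2^-1 1; rewrite powR1;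
    apply; rewrite ?nnegrE; move: a1; lra.
have K0 : 0 <= K by move: K1; lra.
have DKL0 : 0 <= 6 * D * K / L.
  by rewrite divr_ge0 ?(ltW L0)// !mulr_ge0 ?(ltW D0).
have b0 : 0 < beta by move: b2; lra.
apply: le_trans (moment_doubling a1 b0 bp (_ : 1 <= 10) DKL0 _ mom_base mom_step) _.
- by lra.
- by move=> r; rewrite Rintegral_ge0// => x _; rewrite powR_ge0.
rewrite ge0_ler_powR ?nnegrE ?mulr_ge0 ?expR_ge0 ?(ltW p0)//.
(* [6 * D * K / L <= 1] by the choice of [L], which leaves a constant in [alpha] alone. *)
rewrite ler_wpM2l// ler_expR ler_pdivrMr ?subr_gt0// mulVf ?subr_eq0 ?gt_eqF//.
rewrite ler_pdivrMr// mul1r; apply: le_trans Lbig.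
have : 0 <= D * K * (120 * beta - 6) by rewrite !mulr_ge0 ?(ltW D0)//; move: b2; lra.
by lra.
Qed.

End Core.

Lemma powRD_le (R : realType) (u w p : R) : 0 <= u -> 0 <= w -> 0 <= p ->
  (u + w) `^ p <= 2 `^ p * (u `^ p + w `^ p).
Proof.
move=> u0 w0 p0; wlog uw : u w u0 w0 / u <= w => [main|].
  by have [uw|wu] := orP (le_total u w); last rewrite addrC [_ + w `^ p]addrC; apply: main.
apply: (@le_trans _ _ ((2 * w) `^ p)).
  by rewrite ge0_ler_powR ?nnegrE ?addr_ge0 ?mulr_ge0//; lra.
by rewrite powRM// ler_wpM2l ?powR_ge0// lerDr powR_ge0.
Qed.

Lemma powR_add_le2 (R : realType) (a b p : R) : 0 <= a -> 0 <= b -> 1 <= p ->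
  2 `^ p * (a `^ p + b `^ p) <= (4 * (a + b)) `^ p.
Proof.
move=> a0 b0 p1; have p0 : 0 <= p by lra.
have mono x : 0 <= x -> x <= a + b -> x `^ p <= (a + b) `^ p.
  by move=> x0 xab; rewrite ge0_ler_powR ?nnegrE ?addr_ge0.
have -> : 4 * (a + b) = 2 * (2 * (a + b)) by ring.
rewrite powRM ?mulr_ge0 ?addr_ge0// ler_wpM2l ?powR_ge0// powRM ?addr_ge0//.
apply: (@le_trans _ _ (2 * (a + b) `^ p)).
  by have := mono a a0; have := mono b b0; rewrite lerDl lerDr => /(_ a0) ? /(_ b0) ?; lra.
by rewrite ler_wpM2r ?powR_ge0// le1r_powR//; lra.
Qed.

(** * Calculus of [p]-th moment bounds *)

Section Moments.
Context {d : measure_display} {T : measurableType d} {R : realType}.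
Context (mu : probability T R) (p : R).
Hypothesis p1 : 1 <= p.
Implicit Types (f g : T -> R) (B c : R).

(** Stated without roots and in the extended reals, so the bound itself asserts finiteness of the
    moment. *)
Definition moment_le f B := (\int[mu]_x (`|f x| `^ p)%:E <= (B `^ p)%:E)%E.

Let p0 : 0 <= p. Proof. by move: p1; lra. Qed.

Lemma moment_le_mono f g B : (forall x, `|f x| <= `|g x|) -> moment_le g B -> moment_le f B.
Proof.
move=> fg; apply: le_trans; apply: ge0_le_integralT => x; rewrite lee_fin ?powR_ge0//.
by rewrite ge0_ler_powR ?nnegrE.
Qed.

Lemma moment_le_weaken f B B' : 0 <= B -> B <= B' -> moment_le f B -> moment_le f B'.
Proof.
move=> B0 BB' h; apply: le_trans h _.
by rewrite lee_fin ge0_ler_powR ?nnegrE// (le_trans B0).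
Qed.

Lemma measurable_powR_norm f : measurable_fun [set: T] f ->
  measurable_fun [set: T] (fun x => (`|f x| `^ p)%:E).
Proof.
move=> mf; apply/measurable_EFinP; apply: (measurableT_comp (measurable_powR p)).
exact: measurableT_comp.
Qed.

Lemma moment_leZ f B c : 0 <= B -> measurable_fun [set: T] f -> moment_le f B ->
  moment_le (fun x => c * f x) (`|c| * B).
Proof.
move=> B0 mf; rewrite /moment_le => fB.
have -> : (fun x => (`|c * f x| `^ p)%:E) =
    (fun x => (`|c| `^ p)%:E * (`|f x| `^ p)%:E)%E.
  by apply/funext => x; rewrite normrM powRM// EFinM.
rewrite ge0_integralZl_EFin ?powR_ge0//.
- by rewrite (powRM _ (normr_ge0 c) B0) EFinM lee_wpmul2l// lee_fin powR_ge0.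
- exact: measurable_powR_norm.
Qed.

(** A factor 4 in place of Minkowski: [(u + w) ^ p <= 2 ^ p (u ^ p + w ^ p)], then
    [B ^ p + B' ^ p <= (2 (B + B')) ^ p]. *)
Lemma moment_leD f g B B' : 0 <= B -> 0 <= B' ->
  measurable_fun [set: T] f -> measurable_fun [set: T] g ->
  moment_le f B -> moment_le g B' -> moment_le (fun x => f x + g x) (4 * (B + B')).
Proof.
move=> B0 B'0 mf mg fB gB'.
have mf' := measurable_powR_norm mf; have mg' := measurable_powR_norm mg.
have ge0 (h : T -> R) x : (0 <= (`|h x| `^ p)%:E)%E by rewrite lee_fin powR_ge0.
apply: (@le_trans _ _
    (\int[mu]_x ((2 `^ p)%:E * ((`|f x| `^ p)%:E + (`|g x| `^ p)%:E)))%E).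
  apply: ge0_le_integralT => x; first by rewrite lee_fin powR_ge0.
  rewrite -EFinD -EFinM lee_fin; apply: le_trans (powRD_le _ _ p0) => //.
  by rewrite ge0_ler_powR ?nnegrE ?addr_ge0// ler_normD.
rewrite ge0_integralZl_EFin ?powR_ge0//; last 2 first.
- by move=> x _; rewrite adde_ge0.
- exact: emeasurable_funD.
rewrite ge0_integralD//.
apply: (@le_trans _ _ ((2 `^ p)%:E * ((B `^ p)%:E + (B' `^ p)%:E))%E).
  by rewrite lee_wpmul2l ?lee_fin ?powR_ge0// leeD.
by rewrite -EFinD -EFinM lee_fin powR_add_le2.
Qed.

Lemma moment_le_cst c : moment_le (fun=> c) `|c|.
Proof. by rewrite /moment_le integral_cst// [X in (_ * X)%E]probability_setT mule1. Qed.

(* From [u <= B (1 + (u / B) ^ p)]. *)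
Lemma moment_le_mean f B : 0 < B -> measurable_fun [set: T] f -> moment_le f B ->
  (\int[mu]_x (`|f x|)%:E <= (2 * B)%:E)%E.
Proof.
move=> B0 mf fB; have BpN : 0 < B `^ p by rewrite powR_gt0.
have pw x : `|f x| <= B + B / B `^ p * `|f x| `^ p.
  have [fx|fx] := lerP `|f x| B.
    by rewrite ler_wpDr// mulr_ge0 ?powR_ge0// divr_ge0 ?powR_ge0// ltW.
  rewrite ler_wpDl ?(ltW B0)//.
  have -> : B / B `^ p * `|f x| `^ p = B * (`|f x| / B) `^ p.
    rewrite [(_ / B) `^ p]powRM ?invr_ge0 ?(ltW B0)//.
    have -> : B^-1 `^ p = (B `^ p)^-1.
      apply: (mulfI (lt0r_neq0 BpN)); rewrite -powRM ?invr_ge0 ?(ltW B0)//.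
      by rewrite !mulfV ?gt_eqF// powR1.
    by ring.
  rewrite -ler_pdivrMl// mulrC; apply: le1r_powR => //.
  by rewrite ler_pdivlMr// mul1r ltW.
apply: (@le_trans _ _ (\int[mu]_x (B%:E + (B / B `^ p)%:E * (`|f x| `^ p)%:E))%E).
  by apply: ge0_le_integralT => x; rewrite -?EFinM -?EFinD lee_fin.
have c0 : 0 <= B / B `^ p by rewrite divr_ge0 ?powR_ge0// ltW.
have mf' := measurable_powR_norm mf.
rewrite ge0_integralD//; [|by move=> x _; rewrite lee_fin ltW
  |by move=> x _; rewrite -EFinM lee_fin mulr_ge0 ?powR_ge0|exact: emeasurable_funM].
rewrite integral_cst// [X in (_ * X)%E]probability_setT mule1 ge0_integralZl_EFin//.
apply: (@le_trans _ _ (B%:E + (B / B `^ p)%:E * (B `^ p)%:E)%E).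
  by rewrite leeD2l// lee_wpmul2l ?lee_fin.
by rewrite -EFinM -EFinD lee_fin divfK ?gt_eqF//; lra.
Qed.

End Moments.

(** Take [c] within [e] of the infimum of the levels whose upper tail is at most 1/2. Then [c - e]
    is no such level, so its upper tail exceeds 1/2 and the lower tail is at most 1/2. *)
Lemma near_median (d : measure_display) (T : measurableType d) (R : realType)
    (mu : probability T R) (f : T -> R) (e : R) : bounded_measurable f -> 0 < e ->
  exists c : R, (mu [set x | (c < f x)%R] <= (2^-1)%:E)%E /\
    (mu [set x | (f x < c - e)%R] <= (2^-1)%:E)%E.
Proof.
move=> [mf [M fM]] e0.
have mgt c : measurable [set x | c < f x].
  have -> : [set x | c < f x] = f @^-1` `]c, +oo[%classic.
    by apply/seteqP; split=> x /=; rewrite in_itv/= andbT.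
  by rewrite -[X in measurable X]setTI; apply: mf.
have mlt c : measurable [set x | f x < c].
  have -> : [set x | f x < c] = f @^-1` `]-oo, c[%classic.
    by apply/seteqP; split=> x /=; rewrite in_itv/=.
  by rewrite -[X in measurable X]setTI; apply: mf.
pose S := [set c : R | (mu [set x | (c < f x)%R] <= (2^-1)%:E)%E].
have SM : S M.
  rewrite /S /=; have -> : [set x | M < f x] = set0.
    apply/seteqP; split=> x //=; rewrite ltNge => /negP; apply.
    exact: le_trans (ler_norm _) (fM x).
  by rewrite measure0 lee_fin.
have Slb c : S c -> - M <= c.
  move=> Sc; rewrite leNgt; apply/negP => cM.
  move: Sc; rewrite /S /=; have -> : [set x | c < f x] = setT.
    apply/seteqP; split=> x //= _; apply: lt_le_trans cM _.
    by have := fM x; rewrite ler_norml => /andP[].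
  by rewrite [X in (X <= _)%E]probability_setT lee_fin => ?; lra.
have infS : has_inf S by split; [exists M | exists (- M) => c; apply: Slb].
have [c Sc cS] := inf_adherent e0 infS; exists c; split => //.
have nS : ~ S (c - e) by move=> /(ge_inf infS.2); lra.
have {nS} /ltW : ((2^-1)%:E < mu [set x | (c - e < f x)%R])%E by rewrite ltNge; apply/negP.
have : (mu [set x | (f x < c - e)%R] + mu [set x | (c - e < f x)%R] <= 1)%E.
  rewrite -measureU//; first exact: probability_le1 (measurableU _ _ (mlt _) (mgt _)).
  by apply/seteqP; split=> x //= -[]; lra.
have : mu [set x | (f x < c - e)%R] \is a fin_num by rewrite fin_num_measure.
have : mu [set x | (c - e < f x)%R] \is a fin_num by rewrite fin_num_measure.
case: (mu _) => [u| |] // _; case: (mu _) => [w| |] // _.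
by rewrite -EFinD !lee_fin; lra.
Qed.

(** * Deviation from the mean for bounded smooth functions *)

Section BoundedMoment.
Context {R : realType} {n : nat} {Psi : 'rV[R]_n -> R}.
Context (alpha beta K D : R) {mu : probability (borel_rV R n) R}.
Hypotheses (a1 : 1 < alpha) (ab : alpha <= beta) (b2 : 2 <= beta) (K1 : 1 <= K) (D0 : 0 < D).
Hypothesis PsiC : condition_C Psi.
Hypothesis Psi_convex : @convex_function R 'rV[R]_n [set: 'rV[R]_n] Psi.
Hypothesis PsiG : growth K alpha beta Psi.
Hypothesis mu_mLSI : mLSI mu Psi D.

(* The factor 120 makes the entropy rate of the lowest moments at most 1/10. *)
Definition mLSI_scale := Num.max 1 (120 * D * K * beta).
(** [96 = 8 * 12]: adding the two one-sided bounds costs [4 * 2], and passing from the near-median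
    to the mean costs [4 * (1 + 2)]. *)
Definition mLSI_const := 96 * mLSI_scale * (10 * expR ((1 - 2^-1 `^ (alpha - 1))^-1)).

Lemma mLSI_scale_ge1 : 1 <= mLSI_scale.
Proof. by rewrite /mLSI_scale le_max lexx. Qed.

Lemma mLSI_const_gt0 : 0 < mLSI_const.
Proof.
have := mLSI_scale_ge1 => ?.
by rewrite /mLSI_const !mulr_gt0 ?expR_gt0//; lra.
Qed.

Context {p a : R} {g : 'rV[R]_n -> R} {dg : 'rV[R]_n -> 'rV[R]_n -> R} {h : 'rV[R]_n -> R}.
Hypotheses (bp : beta <= p) (a0 : 0 < a).
Hypothesis sg : smooth g dg.
Hypothesis g_bounded : exists M : R, forall x, `|g x| <= M.
Hypothesis h0 : forall x, 0 < h x.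
Hypothesis mh : measurable_fun [set: borel_rV R n] (h : borel_rV R n -> R).
Hypothesis dg_le : forall x y, A_set Psi p y -> `|dg x y| <= h x.
Hypothesis h_moment : moment_le mu p (h : borel_rV R n -> R) a.

Let p1 : 1 <= p. Proof. by move: b2 bp; lra. Qed.
Let p0 : 0 <= p. Proof. by move: p1; lra. Qed.
Let aL := a * mLSI_scale.
Let aL0 : 0 < aL.
Proof. by rewrite mulr_gt0// (lt_le_trans ltr01 mLSI_scale_ge1). Qed.
Let Lam := 10 * expR ((1 - 2^-1 `^ (alpha - 1))^-1).
Let Lam0 : 0 < Lam. Proof. by rewrite mulr_gt0// expR_gt0. Qed.

(** One side of the deviation, [s] being the sign. Division by [aL = a * mLSI_scale] makes [h / a]
    the normalised slope bound, of [p]-th moment at most 1. *)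
Let half_moment (s : R) (c : R) : `|s| = 1 ->
  (mu [set x : borel_rV R n | (0 < s * (g x - c))%R] <= (2^-1)%:E)%E ->
  measurable_fun setT (fun x : borel_rV R n => 1 + softplus (aL^-1 * (s * (g x - c)))) /\
  moment_le mu p (fun x : borel_rV R n => 1 + softplus (aL^-1 * (s * (g x - c)))) Lam.
Proof.
move=> s1 med.
have sgc : smooth (fun x => aL^-1 * (s * (g x - c))) (fun x y => aL^-1 * (s * dg x y)).
  apply/smoothZ/smoothZ; apply: smooth_eq (smoothD sg (smooth_cst (- c))) _ _ => // x y.
  by rewrite addr0.
have gc_bnd : exists M : R, forall x, `|aL^-1 * (s * (g x - c))| <= M.
  have [M gM] := g_bounded; exists (aL^-1 * (M + `|c|)) => x.
  rewrite normrM gtr0_norm ?invr_gt0// ler_wpM2l ?invr_ge0 ?(ltW aL0)//.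
  by rewrite normrM s1 mul1r (le_trans (ler_normB _ _))// lerD2r.
have H0 x : 0 < a^-1 * h x by rewrite mulr_gt0// invr_gt0.
have mH : measurable_fun [set: borel_rV R n] ((fun x => a^-1 * h x) : borel_rV R n -> R).
  exact: measurable_funM.
have dgc_le x y : A_set Psi p y -> aL^-1 * (s * dg x y) <= a^-1 * h x / mLSI_scale.
  move=> Ay; have -> : a^-1 * h x / mLSI_scale = aL^-1 * h x.
    by rewrite /aL invfM; ring.
  rewrite ler_wpM2l ?invr_ge0 ?(ltW aL0)//; apply: le_trans (ler_norm _) _.
  by rewrite normrM s1 mul1r dg_le.
have H_moment : (\int[mu]_x ((a^-1 * h x) `^ p)%:E <= 1)%E.
  have := moment_leZ a^-1 (ltW a0) mh h_moment; rewrite /moment_le.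
  rewrite gtr0_norm ?invr_gt0// mulVf ?gt_eqF// powR1.
  by apply: le_trans; apply: ge0_le_integralT => x; rewrite lee_fin ?powR_ge0// gtr0_norm.
have med' : (mu [set x : borel_rV R n | (0 < aL^-1 * (s * (g x - c)))%R] <= (2^-1)%:E)%E.
  apply: le_trans med; rewrite le_eqVlt; apply/orP; left; apply/eqP; congr (mu _).
  have k0 : 0 < aL^-1 by rewrite invr_gt0.
  by apply/seteqP; split=> x /=; rewrite (pmulr_rgt0 _ k0).
have Lbig : 120 * D * K * beta <= mLSI_scale by rewrite /mLSI_scale le_max lexx orbT.
have main := self_normalized_moment a1 ab b2 K1 D0 PsiC Psi_convex PsiG mu_mLSI bp
  mLSI_scale_ge1 Lbig sgc gc_bnd H0 mH dgc_le H_moment med'.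
have cv : continuous (fun x : 'rV[R]_n => 1 + softplus (aL^-1 * (s * (g x - c)))).
  apply: smooth_continuous; apply: smoothD; first exact: smooth_cst.
  exact: smooth_comp is_derive_softplus continuous_sigmoid sgc.
have mv := continuous_measurable_rV cv; split => //.
have v0 (x : borel_rV R n) : 0 <= 1 + softplus (aL^-1 * (s * (g x - c))).
  by rewrite ltW// softplus_gt0.
have bmv : bounded_measurable
    (fun x : borel_rV R n => 1 + softplus (aL^-1 * (s * (g x - c)))).
  split=> //; have [M gM] := gc_bnd; exists (1 + (M + 1)) => x; rewrite ger0_norm//.
  rewrite lerD2l; apply: le_trans (softplus_le _) _; rewrite lerD2r ge_max.
  by rewrite (le_trans _ (gM x))//= (le_trans (ler_norm _) (gM x)).
rewrite /moment_le; under eq_integral do rewrite ger0_norm//.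
rewrite (expectation_EFin (bm_integrable mu (bm_powR p0 v0 bmv))).
by rewrite lee_fin.
Qed.

Lemma bounded_moment : moment_le mu p
  (fun x : borel_rV R n => g x - \int[mu]_x (g x)) (mLSI_const * a).
Proof.
have bg : bounded_measurable (g : borel_rV R n -> R).
  by split => //; apply: continuous_measurable_rV; apply: smooth_continuous sg.
have [c [med1 med2]] := near_median mu bg aL0.
have [|m1 v1] := @half_moment 1 c (normr1 _).
  apply: le_trans med1; rewrite le_eqVlt; apply/orP; left; apply/eqP; congr (mu _).
  by apply/seteqP; split=> x /=; rewrite mul1r subr_gt0.
have [||m2 v2] := @half_moment (-1) (c - aL); first by rewrite normrN1.
  apply: le_trans med2; rewrite le_eqVlt; apply/orP; left; apply/eqP; congr (mu _).
  by apply/seteqP; split=> x /=; rewrite mulN1r opprB subr_gt0.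
set w1 := fun x : borel_rV R n => _ in m1 v1; set w2 := fun x : borel_rV R n => _ in m2 v2.
have gc_le (x : borel_rV R n) : `|g x - c| <= `|aL * (w1 x + w2 x)|.
  have w10 : 0 < w1 x by rewrite softplus_gt0.
  have w20 : 0 < w2 x by rewrite softplus_gt0.
  rewrite [leRHS]gtr0_norm; last by rewrite mulr_gt0// addr_gt0.
  have p_1 : aL * (aL^-1 * (1 * (g x - c))) <= aL * (w1 x).
    rewrite ler_pM2l// /w1 ler_wpDl//; exact: softplus_ge.
  (* The near-median is off by [aL] on the lower side; the constant 1 in [w2] pays for exactly this
     shift. *)
  have p_2 : aL * (aL^-1 * (-1 * (g x - (c - aL)))) + aL <= aL * (w2 x).
    have : aL * (aL^-1 * (-1 * (g x - (c - aL))) + 1) <= aL * (w2 x).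
      by rewrite ler_pM2l// /w2 addrC lerD2l softplus_ge.
    by rewrite [leLHS]mulrDr mulr1.
  move: p_1 p_2; rewrite !mulVKf ?gt_eqF// mul1r mulN1r => p_1 p_2.
  have q1 : 0 < aL * w1 x by rewrite mulr_gt0.
  have q2 : 0 < aL * w2 x by rewrite mulr_gt0.
  by rewrite mulrDr ler_norml; apply/andP; split; lra.
have mgc : measurable_fun setT (fun x : borel_rV R n => g x - c).
  by apply: measurable_funB => //; case: bg.
pose B := 8 * aL * Lam; have B0 : 0 < B := mulr_gt0 (mulr_gt0 (ltr0Sn _ _) aL0) Lam0.
have gcB : moment_le mu p (fun x : borel_rV R n => g x - c) B.
  apply: (moment_le_mono p1 gc_le).
  have := moment_leZ aL _ (measurable_funD m1 m2)
    (moment_leD p1 (ltW Lam0) (ltW Lam0) m1 m2 v1 v2).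
  rewrite gtr0_norm//; have -> : aL * (4 * (Lam + Lam)) = B by rewrite /B; ring.
  by apply; rewrite mulr_ge0// addr_ge0 ?(ltW Lam0).
have mean := moment_le_mean p1 B0 mgc gcB.
have bgc : bounded_measurable (fun x : borel_rV R n => g x - c).
  by apply: (bmD bg); exact: bm_cst.
pose m := \int[mu]_x (g x).
have cm : `|c - m| <= 2 * B.
  rewrite distrC; have -> : m - c = \int[mu]_x (g x - c).
    by rewrite expectationD//; [rewrite expectation_cst | exact: bm_cst].
  apply: le_trans (le_normr_Rintegral _ (bm_integrable mu bgc)) _ => //.
  rewrite -lee_fin -expectation_EFin//.
  by apply: integrable_norm; exact: bm_integrable.
have -> : (fun x => g x - \int[mu]_x (g x)) = (fun x => (g x - c) + (c - m)).
  by apply/funext => x; rewrite addrA subrK.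
have := moment_leD p1 (ltW B0) (normr_ge0 (c - m)) mgc
  (measurable_cst (c - m)) gcB (moment_le_cst mu p _).
apply: moment_le_weaken => //; first by rewrite mulr_ge0// addr_ge0// ltW.
by rewrite /mLSI_const -/Lam; move: cm; rewrite /B /aL; lra.
Qed.

End BoundedMoment.

Lemma continuous_powR_norm (R : realType) (p : R) : 1 <= p ->
  continuous (fun t : R => `|t| `^ p).
Proof.
move=> p1 t; have [->|t0] := eqVneq t 0.
  apply/cvgrPdist_lt => e e0; apply/nbhs_ballP; exists (Num.min 1 e).
    by rewrite /= lt_min ltr01.
  move=> u; rewrite /ball_ /= sub0r normrN lt_min => /andP[u1 ue].
  rewrite normr0 powR0; last by rewrite gt_eqF//; lra.
  rewrite sub0r normrN ger0_norm ?powR_ge0//.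
  have [->|u0] := eqVneq u 0; first by rewrite normr0 powR0// gt_eqF//; lra.
  apply: le_lt_trans ue; apply: ge1r_powR => //.
  by rewrite normr_gt0 u0 ltW.
apply: (@continuous_comp _ _ _ (fun u : R => `|u|) (fun u => u `^ p)).
  exact: norm_continuous.
apply: (differentiable_continuous (f := fun u => u `^ p)).
have t0' : 0 < `|t| by rewrite normr_gt0.
by have [? _] := is_derive1_powR p t0'; exact/derivable1_diffP.
Qed.

Lemma integral_cvg_le (d : measure_display) (T : measurableType d) (R : realType)
    (mu : {measure set T -> \bar R}) (h : nat -> T -> R) (f : T -> R) (C : \bar R) :
  (forall m, measurable_fun [set: T] (h m)) -> (forall m x, 0 <= h m x) ->
  (forall x, h m x @[m --> \oo] --> f x) ->
  (forall m, \int[mu]_x (h m x)%:E <= C)%E -> (\int[mu]_x (f x)%:E <= C)%E.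
Proof.
move=> mh h0 hf hC.
have mh' m : measurable_fun [set: T] (fun x => (h m x)%:E) by apply/measurable_EFinP.
have h0' m x : [set: T] x -> (0 <= (h m x)%:E)%E by rewrite lee_fin.
have := fatou mu measurableT mh' h0'.
rewrite (_ : (fun x => limn_einf _) = (fun x => (f x)%:E)); last first.
  apply/funext => x; apply: (cvg_limn_einf_sup _).1.
  by apply: cvg_EFin; [exact: nearW | exact: hf].
move=> h1; apply: le_trans h1 _; rewrite limn_einf_lim; apply: lime_le.
  exact: is_cvg_einfs.
apply: nearW => m; apply: le_trans (hC m).
by apply: ereal_inf_lbound; exists m => /=.
Qed.

(** * Passing moment bounds to a limit not known to be integrable *)

Section MomentLimit.
Context {d : measure_display} {T : measurableType d} {R : realType}.
Context {mu : probability T R} {p B : R} {g : nat -> T -> R} {f : T -> R}.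
Hypotheses (p1 : 1 <= p) (B0 : 0 < B).
Hypothesis bg : forall m, bounded_measurable (g m).
Hypothesis gf : forall x, g m x @[m --> \oo] --> f x.
Hypothesis g_le : forall m x, `|g m x| <= f x + 1.
Hypothesis f0 : forall x, 0 <= f x.
Hypothesis g_moment : forall m, moment_le mu p (fun x => g m x - \int[mu]_x (g m x)) B.

Let mean m : R := \int[mu]_x (g m x).

Let mf : measurable_fun [set: T] f.
Proof. by apply: (measurable_fun_cvg (h := g)) => // m; case: (bg m). Qed.

Let mg m : measurable_fun [set: T] (fun x => g m x - mean m).
Proof. by apply: measurable_funB => //; case: (bg m). Qed.

Let dev_le m : (\int[mu]_x (`|g m x - mean m|)%:E <= (2 * B)%:E)%E.
Proof. exact (moment_le_mean p1 B0 (mg m) (g_moment m)). Qed.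

(** The sublevel sets of the finite function [f] increase to the whole space. *)
Let f_tight : exists N : nat, ((2^-1)%:E < mu [set x | (f x <= N%:R)%R])%E.
Proof.
apply: contrapT => /forallNP h.
pose F N := [set x | (f x <= N%:R)%R].
have mF N : measurable (F N).
  have -> : F N = f @^-1` `]-oo, N%:R]%classic.
    by apply/seteqP; split=> x /=; rewrite in_itv/=.
  by rewrite -[X in measurable X]setTI; apply: mf.
have FT : \bigcup_N F N = setT.
  apply/seteqP; split=> x // _; exists (Num.bound (f x)) => //.
  by rewrite /F /= ltW// archi_boundP.
have : mu (F N) @[N --> \oo] --> mu (\bigcup_N F N).
  apply: nondecreasing_cvg_mu => //; first by rewrite FT.
  move=> m k mk; apply/subsetPset => x /= fm; apply: le_trans fm _.
  by rewrite ler_nat.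
rewrite FT [X in _ --> X]probability_setT => c.
have : (lim (mu (F N) @[N --> \oo]) <= (2^-1)%:E)%E.
  apply: lime_le; first by apply/cvg_ex; exists 1%E.
  by apply: nearW => N; rewrite leNgt; apply/negP/h.
by rewrite (cvg_lim _ c)// lee_fin; lra.
Qed.

(** On a set of mass above 1/2 all [g m] are at most [N + 1] in absolute value. A larger mean would
    force a deviation above [4 * B] there, contradicting the mean deviation [2 * B]. *)
Let mean_bounded : exists C : R, forall m, `|mean m| <= C.
Proof.
have [N muN] := f_tight; exists (N%:R + 1 + 4 * B) => m.
rewrite leNgt; apply/negP => big.
pose F := [set x | (f x <= N%:R)%R].
have mF : measurable F.
  have -> : F = f @^-1` `]-oo, N%:R]%classic.
    by apply/seteqP; split=> x /=; rewrite in_itv/=.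
  by rewrite -[X in measurable X]setTI; apply: mf.
have : ((4 * B)%:E * mu F <= (2 * B)%:E)%E.
  apply: le_trans (dev_le m); rewrite -[F]setIT -integral_indic//.
  rewrite -ge0_integralZl_EFin//; last 2 first.
  - by apply/measurable_EFinP; exact: measurable_indic.
  - by rewrite mulr_ge0// ltW.
  apply: ge0_le_integralT => x; rewrite -EFinM lee_fin indicE.
    by rewrite mulr_ge0// mulr_ge0// ltW.
  have [xF|] := boolP (x \in F); last by rewrite mulr0.
  move: xF; rewrite inE /F /= mulr1 => fN.
  have := g_le m x; have := ler_normB (g m x) (g m x - mean m).
  by rewrite subKr; lra.
apply/negP; rewrite -ltNge; have -> : 2 * B = 4 * B * 2^-1 by field.
by rewrite EFinM lte_pmul2l// lte_fin mulr_gt0.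
Qed.

Lemma limit_integrable : mu.-integrable [set: T] (EFin \o f).
Proof.
have [C meanC] := mean_bounded; apply/integrableP; split.
  exact/measurable_EFinP.
under eq_integral do rewrite /= ger0_norm//.
apply: (@le_lt_trans _ _ (2 * B + C)%:E); last exact: ltry.
apply: (integral_cvg_le (h := fun m x => `|g m x|)).
- by move=> m; apply: measurableT_comp => //; case: (bg m).
- by [].
- by move=> x; rewrite -(ger0_norm (f0 x)); apply: cvg_norm.
move=> m; apply: (@le_trans _ _ (\int[mu]_x ((`|g m x - mean m|)%:E + C%:E))%E).
  apply: ge0_le_integralT => x; rewrite -?EFinD lee_fin//.
  apply: le_trans (_ : _ <= `|g m x - mean m| + `|mean m|) _; last by rewrite lerD2l.
  by rewrite -{1}[g m x](subrK (mean m)) ler_normD.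
have C0 : 0 <= C by apply: le_trans (meanC 0%N).
rewrite ge0_integralD//.
- rewrite integral_cst// [X in (_ * X)%E]probability_setT mule1 EFinD leeD2r//.
- by apply/measurable_EFinP; apply: measurableT_comp.
Qed.

(** Once [f] is integrable, [f + 1] dominates the sequence, so the means converge; Fatou then
    applies to the centred powers. *)
Lemma limit_moment : moment_le mu p (fun x => f x - \int[mu]_x (f x)) B.
Proof.
have intf := limit_integrable.
have intf1 : mu.-integrable [set: T] (fun x => (f x + 1)%:E).
  under eq_fun do rewrite EFinD.
  by apply: integrableD => //; exact: finite_measure_integrable_cst.
have mg' m : measurable_fun [set: T] (EFin \o g m).
  by apply/measurable_EFinP; case: (bg m).
have mf' : measurable_fun [set: T] (EFin \o f) by apply/measurable_EFinP.
have cv : {ae mu, forall x, [set: T] x -> (EFin \o g m) x @[m --> \oo] --> (EFin \o f) x}.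
  apply: nearW => x _; apply: cvg_EFin; [exact: nearW | exact: gf].
have dom : {ae mu, forall x, forall m, [set: T] x -> (`|(EFin \o g m) x| <= (f x + 1)%:E)%E}.
  by apply: nearW => x m _; rewrite /= lee_fin.
have [_ _ mean_cvg] := dominated_convergence measurableT mg' mf' cv intf1 dom.
have mean_cvg' : mean m @[m --> \oo] --> \int[mu]_x (f x).
  rewrite /mean /Rintegral; apply: fine_cvg.
  by rewrite fineK//; exact: integrable_fin_num.
apply: (integral_cvg_le (h := fun m x => `|g m x - mean m| `^ p)) => //.
- move=> m; apply: (measurableT_comp (measurable_powR p)).
  exact: measurableT_comp.
- move=> x; have cB : (g m x - mean m) @[m --> \oo] --> f x - \int[mu]_x (f x).
    by apply: cvgB.
  exact: cvg_comp cB (@continuous_powR_norm R p p1 (f x - \int[mu]_x (f x))).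
Qed.

End MomentLimit.

(** * Bounded smooth approximation of a countable supremum *)

Section SmoothApprox.
Context {R : realType} {n : nat} (A : set 'rV[R]_n) (h : 'rV[R]_n -> R).
Implicit Types (f g : 'rV[R]_n -> R) (df dg : 'rV[R]_n -> 'rV[R]_n -> R) (e : R).
Hypothesis h0 : forall x, 0 <= h x.

Definition slope_le f df := smooth f df /\ forall x y, A y -> `|df x y| <= h x.

Lemma slope_le_cst (c : R) : slope_le (fun=> c) (fun _ _ => 0).
Proof. by split=> [|x y _]; [exact: smooth_cst | rewrite normr0]. Qed.

Lemma slope_leN f df : slope_le f df -> slope_le (fun x => - f x) (fun x y => - df x y).
Proof.
by move=> [sf dfh]; split=> [|x y Ay]; [exact: smoothN | rewrite normrN dfh].
Qed.

(** The log-sum-exp maximum [e * ln (exp (a / e) + exp (b / e))]. *)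
Definition smax e (a b : R) := a + e * softplus (e^-1 * (b - a)).

Lemma smax_gel e a b : 0 < e -> a <= smax e a b.
Proof. by move=> e0; rewrite lerDl mulr_ge0 ?softplus_ge0// ltW. Qed.

Lemma smax_ger e a b : 0 < e -> b <= smax e a b.
Proof.
move=> e0; have : e * (e^-1 * (b - a)) <= e * softplus (e^-1 * (b - a)).
  by rewrite ler_pM2l// softplus_ge.
by rewrite mulVKf ?gt_eqF// /smax; lra.
Qed.

Lemma smax_le e a b : 0 < e -> smax e a b <= Num.max a b + e.
Proof.
move=> e0; have : e * softplus (e^-1 * (b - a)) <= e * (Num.max 0 (e^-1 * (b - a)) + 1).
  by rewrite ler_pM2l// softplus_le.
have -> : e * (Num.max 0 (e^-1 * (b - a)) + 1) = Num.max 0 (b - a) + e.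
  by rewrite mulrDr mulr1 maxr_pMr ?(ltW e0)// mulr0 mulVKf ?gt_eqF.
rewrite /smax; have [?|?] := lerP a b; have [?|?] := lerP 0 (b - a); lra.
Qed.

Definition slope_max e f df g dg x y :=
  df x y + sigmoid (e^-1 * (g x - f x)) * (dg x y - df x y).

(** The differential is the convex combination of [df] and [dg] with weight [sigmoid], so the slope
    bound [h] is preserved without loss, however many maxima are iterated. *)
Lemma slope_le_max e f df g dg : 0 < e -> slope_le f df -> slope_le g dg ->
  slope_le (fun x => smax e (f x) (g x)) (slope_max e f df g dg).
Proof.
move=> e0 [sf dfh] [sg dgh]; split=> [|x y Ay].
  have st := smoothZ e^-1 (smoothD sg (smoothN sf)).
  have ss := smoothZ e (smooth_comp is_derive_softplus continuous_sigmoid st).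
  apply: smooth_eq (smoothD sf ss) _ _ => // x y; rewrite /slope_max.
  by field; rewrite gt_eqF.
rewrite /slope_max; set s := sigmoid _.
have s0 : 0 <= s := sigmoid_ge0 _; have s1 : s <= 1 := sigmoid_le1 _.
have := dfh x y Ay; have := dgh x y Ay; rewrite !ler_norml.
move=> /andP[g1 g2] /andP[f1 f2].
have -> : df x y + s * (dg x y - df x y) = (1 - s) * df x y + s * dg x y by ring.
have s1' : 0 <= 1 - s by lra.
have := ler_wpM2l s1' f1; have := ler_wpM2l s1' f2.
have := ler_wpM2l s0 g1; have := ler_wpM2l s0 g2.
by move=> ? ? ? ?; apply/andP; split; lra.
Qed.

Context {u : nat -> 'rV[R]_n -> R} {du : nat -> 'rV[R]_n -> 'rV[R]_n -> R}.
Context {F : 'rV[R]_n -> R}.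
Hypothesis u_slope : forall i, slope_le (u i) (du i).
Hypothesis F0 : forall x, 0 <= F x.
Hypothesis u_le : forall i x, u i x <= F x.
Hypothesis u_sup : forall x e, 0 < e -> exists i, F x - e <= u i x.

Fixpoint smax_iter e k x : R :=
  if k is k'.+1 then smax e (smax_iter e k' x) (u k' x) else 0.

Lemma smax_iter_slope e k : 0 < e -> exists df, slope_le (smax_iter e k) df.
Proof.
move=> e0; elim: k => [|k [df IH]]; first by eexists; exact: slope_le_cst.
by eexists; exact: (slope_le_max e0 IH (u_slope k)).
Qed.

Lemma smax_iter_ge0 e k x : 0 < e -> 0 <= smax_iter e k x.
Proof.
by move=> e0; elim: k => //= k IH; apply: le_trans IH _; exact: smax_gel.
Qed.

Lemma smax_iter_ge e k i x : 0 < e -> (i < k)%N -> u i x <= smax_iter e k x.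
Proof.
move=> e0; elim: k => //= k IH; rewrite ltnS leq_eqVlt => /orP[/eqP ->|ik].
  exact: smax_ger.
by apply: le_trans (IH ik) _; exact: smax_gel.
Qed.

Lemma smax_iter_le e k x : 0 < e -> smax_iter e k x <= F x + k%:R * e.
Proof.
move=> e0; elim: k => [|k IH] /=; first by rewrite mul0r addr0.
apply: le_trans (smax_le _ _ e0) _; rewrite -natr1 mulrDl mul1r addrA lerD2r ge_max IH/=.
by apply: le_trans (u_le k x) _; rewrite lerDl mulr_ge0// ltW.
Qed.

(** Quadratic decay: the [m] successive smoothings together cost at most
    [m * eps m <= 1 / (m + 1)]. *)
Let eps (m : nat) : R := (m.+1%:R ^+ 2)^-1.
Let eps0 m : 0 < eps m. Proof. by rewrite invr_gt0 exprn_gt0. Qed.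

Let eps_le m : m%:R * eps m <= m.+1%:R^-1.
Proof.
rewrite /eps ler_pdivrMr ?exprn_gt0// expr2 mulrA mulVf ?pnatr_eq0// mul1r.
by rewrite ler_nat.
Qed.

Let eps_le1 m : eps m <= m.+1%:R^-1.
Proof.
rewrite lef_pV2 ?posrE ?exprn_gt0//; rewrite expr2 ler_peMr// ler1n//.
Qed.

(** A smooth minimum of [m] and [smax_iter]: the truncation makes it bounded. Truncation level,
    number of functions and smoothing error are all governed by [m]. *)
Definition smooth_below m x : R := - smax (eps m) (- m%:R) (- smax_iter (eps m) m x).

Lemma smooth_below_slope m : exists df, slope_le (smooth_below m) df.
Proof.
have [df hf] := smax_iter_slope m (eps0 m).
by eexists; exact: (slope_leN (slope_le_max (eps0 m) (slope_le_cst _) (slope_leN hf))).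
Qed.

Lemma smooth_below_le m x : smooth_below m x <= Num.min m%:R (F x + m.+1%:R^-1).
Proof.
rewrite le_min /smooth_below; apply/andP; split.
  by rewrite lerNl; exact: smax_gel.
rewrite lerNl; apply: le_trans (smax_ger _ _ (eps0 m)); rewrite lerN2.
by apply: le_trans (smax_iter_le _ _ (eps0 m)) _; rewrite lerD2l.
Qed.

Lemma smooth_below_ge m x :
  Num.min m%:R (smax_iter (eps m) m x) - m.+1%:R^-1 <= smooth_below m x.
Proof.
rewrite /smooth_below lerNr; apply: le_trans (smax_le _ _ (eps0 m)) _.
by rewrite -oppr_min opprB addrC lerD2r.
Qed.

Lemma norm_smooth_below_le m x : `|smooth_below m x| <= Num.min (m%:R + 1) (F x + 1).
Proof.
have m1 : m.+1%:R^-1 <= 1 :> R by rewrite invf_le1// ler1n.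
have ge : -1 <= smooth_below m x.
  apply: le_trans (smooth_below_ge m x).
  have : 0 <= Num.min m%:R (smax_iter (eps m) m x) by rewrite le_min ler0n smax_iter_ge0.
  by move: m1; set t := _^-1; lra.
have := smooth_below_le m x; rewrite !le_min !ler_norml => /andP[h1 h2].
have := F0 x; have : 0 <= m%:R :> R by rewrite ler0n.
by move: m1 h2; set t := _^-1 => ? ? ? ?; apply/andP; split; apply/andP; split; lra.
Qed.

Lemma smooth_below_cvg x : smooth_below m x @[m --> \oo] --> F x.
Proof.
apply/cvgrPdist_le => e e0; have e20 : 0 < e / 2 by lra.
have [i ui] := u_sup x e20.
have m_e : \forall m \near \oo, (m.+1%:R^-1 : R) < e / 2.
  exact: near_infty_natSinv_lt (PosNum e20).
have m_F : \forall m \near \oo, F x <= m%:R.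
  exact: nbhs_infty_ger.
near=> m.
have me : m.+1%:R^-1 < e / 2 by near: m.
have mF : F x <= m%:R by near: m.
have im : (i < m)%N by near: m; exact: nbhs_infty_gt.
have := smooth_below_le m x; rewrite le_min => /andP[_ le1].
have := smooth_below_ge m x.
have : F x - e / 2 <= Num.min m%:R (smax_iter (eps m) m x).
  rewrite le_min; apply/andP; split; first by lra.
  by apply: le_trans ui (smax_iter_ge _ (eps0 m) im).
rewrite ler_norml; move: le1 me; set t := _^-1 => ? ? ? ?.
by apply/andP; split; lra.
Unshelve. all: by end_near. Qed.

End SmoothApprox.

(* Separability of [C @` S], phrased on the side of the parameters. *)
Lemma countable_dense_param (R : realType) (I : finType) (Theta : Type) (S : set Theta)
    (C : Theta -> I -> R) : S !=set0 ->
  exists t : nat -> Theta, (forall m, S (t m)) /\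
    forall s e, S s -> 0 < e -> exists m, forall i, `|C (t m) i - C s i| <= e.
Proof.
move=> [s0 Ss0].
(* Indices are a rational point with a precision; for each, one parameter of [S] is selected if any
   lies that close. Two such errors add up to at most [e]. *)
pose close (qr : {ffun I -> rat} * nat) s :=
  S s /\ forall i, `|C s i - ratr (qr.1 i)| <= qr.2.+1%:R^-1.
have /choice[sel selP] qr : exists s, S s /\ ((exists s', close qr s') -> close qr s).
  have [[s cs]|no] := pselect (exists s, close qr s); last by exists s0.
  by exists s; split => //; case: cs.
exists (fun m => if unpickle m is Some qr then sel qr else s0); split.
  by move=> m; case: unpickle => // qr; case: (selP qr).
move=> s e Ss e0; pose r := Num.bound (2 / e).
have r_e : 2 * r.+1%:R^-1 <= e.
  rewrite ler_pdivrMr// mulrC -ler_pdivrMr//; apply: ltW.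
  have e2 : 0 <= 2 / e by rewrite divr_ge0// ltW.
  by apply: lt_trans (archi_boundP e2) _; rewrite ltr_nat.
have rp : 0 < (r.+1%:R^-1 : R) by rewrite invr_gt0.
have /choice[q qP] i : exists q : rat, `|C s i - ratr q| <= r.+1%:R^-1.
  have lt_i : C s i - r.+1%:R^-1 < C s i + r.+1%:R^-1.
    by rewrite ltrBlDr -addrA ltrDl addr_gt0.
  have [q] := rat_in_itvoo lt_i; rewrite in_itv/= => /andP[q1 q2]; exists q.
  move: q1 q2; set w := ratr q => q1 q2.
  rewrite ler_norml; apply/andP; split.
    by rewrite lerBrDr addrC lerBlDr; exact: ltW.
  by rewrite lerBlDr -lerBlDl; exact: ltW.
pose qr : {ffun I -> rat} * nat := ([ffun i => q i], r).
exists (pickle qr) => i; rewrite pickleK.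
have [_ cl] : close qr (sel qr).
  by apply: (selP qr).2; exists s; split => // j; rewrite ffunE.
have := cl i; rewrite /= ffunE => h1; have h2 := qP i.
have -> : C (sel qr) i - C s i = (C (sel qr) i - ratr (q i)) - (C s i - ratr (q i)) by ring.
by apply: le_trans (ler_normB _ _) _; apply: le_trans r_e; rewrite mulr_natl mulr2n lerD.
Qed.

Lemma smooth_prod (R : realType) (n : nat) (I : eqType) (r : seq I)
    (f : I -> 'rV[R]_n -> R) (df : I -> 'rV[R]_n -> 'rV[R]_n -> R) : uniq r ->
  (forall i, smooth (f i) (df i)) ->
  smooth (fun x => \prod_(i <- r) f i x)
    (fun x v => \sum_(i <- r) df i x v * \prod_(l <- r | l != i) f l x).
Proof.
move=> + sf; elim: r => [_|a r IHr /= /andP[ar ur]].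
  by apply: smooth_eq (smooth_cst 1) _ _ => x *; rewrite big_nil.
apply: smooth_eq (smoothM (sf a) (IHr ur)) _ _ => [x|x v]; first by rewrite big_cons.
rewrite big_cons big_cons eqxx /= addrC mulrC; congr (_ * _ + _).
  rewrite [LHS]big_seq [RHS]big_seq_cond; apply: eq_big => i; last by [].
  by case: eqVneq => [->|]; rewrite ?andbT// (negbTE ar).
rewrite mulr_sumr; apply: eq_big_seq => i ir.
have ai : a != i by apply: contraNneq ar => ->.
by rewrite big_cons ai mulrCA.
Qed.

(** * Linearising the Banach norm, and the multilinear forms it produces *)

Section TensorNorm.
Context {R : realType} {n k : nat} {E : normedModType R} (A : tensor k n E).
Implicit Types (B u : tensor k n R).

Definition tdot u B : R := \sum_i B i * u i.

(** The coordinates [u i = l (A i)] of functionals [l] of norm at most 1 on the span of the entries: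
    only these finitely many values enter the pairings. *)
Definition dual_ball := [set u | (forall B, tdot u B <= `|pairing A B|) /\
  (tensor_sym A -> tensor_sym u)].

Lemma pairingN B : pairing A (fun i => - B i) = - pairing A B.
Proof. by rewrite /pairing -sumrN; apply: eq_bigr => i _; rewrite scaleNr. Qed.

Lemma dual_ball_le u B : dual_ball u -> `|tdot u B| <= `|pairing A B|.
Proof.
move=> [uA _]; rewrite ler_norml uA andbT lerNl -normrN -pairingN.
have <- : tdot u (fun i => - B i) = - tdot u B.
  by rewrite /tdot -sumrN; apply: eq_bigr => i _; rewrite mulNr.
exact: uA.
Qed.

Lemma dual_ball0 : dual_ball (fun=> 0).
Proof.
by split=> [B|_ s i //]; rewrite /tdot big1// => i _; rewrite mulr0.
Qed.

(** A minorant of the norm, linear along the entries of [A] and agreeing with the norm at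
    [pairing A B], supplies the norming functional. *)
Lemma dual_ball_attained B : exists2 u, dual_ball u & tdot u B = `|pairing A B|.
Proof.
have norm_sublinear : sublinear (fun x : E => `|x|).
  split=> [x y|t x t0]; first exact: ler_normD.
  by rewrite normrZ gtr0_norm.
have [phi [phis le_phi phiB phi_odd]] :=
  odd_minorant (pairing A B) [seq A i | i <- enum {ffun 'I_k -> 'I_n}] norm_sublinear.
have phiE B' : phi (pairing A B') = tdot (fun i => phi (A i)) B'.
  rewrite /pairing odd_at_sum// => i; apply: phi_odd.
  by rewrite inE map_f ?orbT// mem_enum.
exists (fun i => phi (A i)); last by rewrite -phiE.
split=> [B'|As s i]; first by rewrite -phiE.
by rewrite As.
Qed.

End TensorNorm.

Section TensorForm.
Context {R : realType} {n k : nat}.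
Implicit Types (u : tensor k n R) (y : seq 'rV[R]_n) (x v : 'rV[R]_n).

Definition form u y x : R := tdot u (tprod k (y ++ nseq (k - size y) x)).

Let slot y x (l : 'I_k) : 'rV[R]_n := if (l < size y)%N then y`_l else x.

Let slotE y x (l : 'I_k) : (y ++ nseq (k - size y) x)`_l = slot y x l.
Proof.
rewrite nth_cat /slot; case: ltnP => // yl.
by rewrite nth_nseq ltn_sub2r// (leq_ltn_trans yl).
Qed.

Let tprodE y x i : tprod k (y ++ nseq (k - size y) x) i = \prod_(l < k) slot y x l 0 (i l).
Proof. by apply: eq_bigr => l _; rewrite slotE. Qed.

Definition form_diff u y x v : R := \sum_(i : {ffun 'I_k -> 'I_n})
  (\sum_(l < k) (if (l < size y)%N then 0 else v 0 (i l)) *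
    \prod_(m < k | m != l) slot y x m 0 (i m)) * u i.

Lemma smooth_form u y : smooth (form u y) (form_diff u y).
Proof.
have sp (i : {ffun 'I_k -> 'I_n}) :
    smooth (fun x => \prod_(l < k) slot y x l 0 (i l)) (fun x v =>
      \sum_(l < k) (if (l < size y)%N then 0 else v 0 (i l)) *
        \prod_(m < k | m != l) slot y x m 0 (i m)).
  apply: (smooth_prod (f := fun l x => slot y x l 0 (i l))
    (df := fun l x v => if (l < size y)%N then 0 else v 0 (i l))).
    exact: index_enum_uniq.
  move=> l; rewrite /slot; case: (l < size y)%N; first exact: smooth_cst.
  exact: smooth_coord.
apply: smooth_eq (smooth_sum _ (fun i => smoothZ (u i) (sp i))) _ _ => [x|x v].
  by apply: eq_bigr => i _; rewrite tprodE mulrC.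
by apply: eq_bigr => i _; rewrite mulrC.
Qed.

(* By symmetry each of the [k - size y] free slots contributes equally: swap it
   with the first free one. *)
Lemma form_diffE u y x v : tensor_sym u -> (size y < k)%N ->
  form_diff u y x v = (k - size y)%:R * form u (rcons y v) x.
Proof.
move=> usym yk; pose j0 := Ordinal yk.
pose term l := \sum_(i : {ffun 'I_k -> 'I_n})
  (v 0 (i l) * \prod_(m < k | m != l) slot y x m 0 (i m)) * u i.
have termE (l : 'I_k) : (size y <= l)%N -> term l = term j0.
  move=> yl; pose t := tperm l j0.
  pose sh (i : {ffun 'I_k -> 'I_n}) := [ffun m => i (t m)].
  have shK : involutive sh by move=> i; apply/ffunP => m; rewrite !ffunE tpermK.
  rewrite {1}/term (reindex_inj (inv_inj shK)); apply: eq_bigr => i _.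
  rewrite usym ffunE tpermL; congr (_ * _ * _).
  rewrite (reindex_inj (@perm_inj _ t)) /=; apply: eq_big => m.
    by rewrite -[in LHS](tpermR l j0) (inj_eq perm_inj).
  move=> ml; rewrite ffunE tpermK; congr (_ 0 _).
  rewrite /t; case: tpermP => [->|->|//]; rewrite /slot ?ltnn /= ltnNge yl//.
have -> : form_diff u y x v = \sum_(l < k | (size y <= l)%N) term l.
  rewrite /form_diff /term [RHS]exchange_big; apply: eq_bigr => i _.
  rewrite -mulr_suml; congr (_ * _); rewrite [RHS]big_mkcond; apply: eq_bigr => l _.
  by rewrite ltnNge; case: leqP; rewrite ?mul0r.
rewrite (eq_bigr (fun=> term j0)) => [|l yl]; last exact: termE.
rewrite sumr_const -[LHS]mulr_natl; congr (_%:R * _).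
  rewrite -sum1_card -(big_mkord (fun l => (size y <= l)%N) (fun=> 1%N)).
  rewrite -(big_nat_widenl (size y) 0 k xpredT (fun=> 1%N))//.
  by rewrite sum_nat_const_nat muln1.
apply: eq_bigr => i _; congr (_ * _).
rewrite /tprod size_rcons [RHS](bigD1 j0) //=; congr (_ * _).
  by rewrite cat_rcons nth_cat ltnn subnn.
apply: eq_bigr => m mj; congr (_ 0 _); rewrite cat_rcons nth_cat /slot.
case: ltngtP => // [ym|ym]; last by move/eqP: mj; case; apply: val_inj.
rewrite -[(m - size y)%N]prednK ?subn_gt0//= nth_nseq.
case: ltnP => //; rewrite leqNgt => /negP[].
by rewrite subnS -ltnS !prednK ?subn_gt0// ltn_sub2r.
Qed.

(** Separates the parameters [(u, y)] from the variable: [form] is linear in [coef] with weights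
    [monom] in [x], so density of coefficient vectors serves every [x] at once. *)
Let coef (uy : tensor k n R * seq 'rV[R]_n) (i : {ffun 'I_k -> 'I_n}) : R :=
  (\prod_(l < k) (if (l < size uy.2)%N then (uy.2)`_l 0 (i l) else 1)) * uy.1 i.

Let monom j x (i : {ffun 'I_k -> 'I_n}) : R :=
  \prod_(l < k) (if (l < j)%N then 1 else x 0 (i l)).

Let formE u y x : form u y x = \sum_i coef (u, y) i * monom (size y) x i.
Proof.
apply: eq_bigr => i _; rewrite tprodE /coef /monom mulrAC -big_split; congr (_ * _).
by apply: eq_bigr => l _; rewrite /slot /=; case: (l < size y)%N; rewrite ?mulr1 ?mul1r.
Qed.

Lemma countable_forms (S : set (tensor k n R * seq 'rV[R]_n)) j : S !=set0 ->
  (forall s, S s -> size s.2 = j) ->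
  exists t : nat -> tensor k n R * seq 'rV[R]_n, (forall m, S (t m)) /\
    forall s x e, S s -> 0 < e ->
      exists m, form s.1 s.2 x - e <= form (t m).1 (t m).2 x.
Proof.
move=> S0 Sj; have [t [tS tdense]] := countable_dense_param coef S0.
exists t; split => // s x e Ss e0.
pose M := 1 + \sum_i `|monom j x i|.
have M0 : 0 < M by rewrite ltr_pwDl// sumr_ge0.
have [m close] := tdense s (e / M) Ss (divr_gt0 e0 M0); exists m.
rewrite !formE (Sj _ Ss) (Sj _ (tS m)) -!surjective_pairing lerBlDl -lerBlDr -sumrB.
apply: le_trans (ler_norm _) _; apply: le_trans (ler_norm_sum _ _ _) _.
apply: (@le_trans _ _ (\sum_i e / M * `|monom j x i|)).
  apply: ler_sum => i _; rewrite -mulrBl normrM ler_wpM2r// distrC; exact: close.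
rewrite -mulr_sumr mulrAC ler_pdivrMr// ler_wpM2l ?(ltW e0)//.
by rewrite /M lerDr.
Qed.

End TensorForm.

Section SupForm.
Context {R : realType} {n k : nat} {E : normedModType R} (A : tensor k n E).
Context (Y : set 'rV[R]_n) {b : R}.
Hypothesis Y0 : Y 0.
Hypothesis Yb : forall y i, Y y -> `|y 0 i| <= b.
Implicit Types (x v : 'rV[R]_n).

Definition form_values j x := [set `|pairing A (tprod k (tval y ++ nseq (k - j) x))| |
  y in [set y : j.-tuple 'rV[R]_n | forall i : 'I_j, Y (tnth y i)]].

Definition supform j x := sup (form_values j x).

Lemma form_values_neq0 j x : form_values j x !=set0.
Proof.
by eexists; exists (nseq_tuple j 0) => // i /=; rewrite tnth_nseq.
Qed.

Lemma form_values_ub j x : has_ubound (form_values j x).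
Proof.
pose c := `|b| + \sum_i `|x 0 i|.
have c0 : 0 <= c by rewrite addr_ge0// sumr_ge0.
exists (\sum_i c ^+ k * `|A i|) => _ [y Yy <-].
rewrite /pairing; apply: le_trans (ler_norm_sum _ _ _) _; apply: ler_sum => i _.
rewrite normrZ ler_wpM2r// /tprod normr_prod.
have -> : c ^+ k = \prod_(l < k) c by rewrite prodr_const card_ord.
apply: ler_prod => l _; rewrite normr_ge0 /= nth_cat size_tuple; case: ltnP => lj.
  rewrite -(tnth_nth 0 y (Ordinal lj)).
  apply: le_trans (Yb _ (Yy _)) _; apply: le_trans (ler_norm b) _.
  by rewrite lerDl sumr_ge0.
rewrite nth_nseq; case: ifP => _; last by rewrite mxE normr0.
rewrite /c (bigD1 (i l)) //= addrCA lerDl addr_ge0// sumr_ge0//.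
Qed.

Lemma supform_ub j x (y : j.-tuple 'rV[R]_n) : (forall i : 'I_j, Y (tnth y i)) ->
  `|pairing A (tprod k (tval y ++ nseq (k - j) x))| <= supform j x.
Proof. by move=> Yy; apply: ub_le_sup; [exact: form_values_ub | exists y]. Qed.

Lemma supform_ge0 j x : 0 <= supform j x.
Proof.
have [_ [y Yy _]] := form_values_neq0 j x.
exact: le_trans (supform_ub x Yy).
Qed.

Lemma ereal_sup_form_values j x :
  ereal_sup [set r%:E | r in form_values j x] = (supform j x)%:E.
Proof.
by rewrite ereal_sup_EFin; [|exact: form_values_ub | exact: form_values_neq0].
Qed.

Lemma supform_full x x' : supform k x = supform k x'.
Proof. by rewrite /supform /form_values subnn. Qed.

Hypothesis Asym : tensor_sym A.

(** Dual functionals replace the norm, so the members are polynomials in [x]. Half of [e] is spent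
    on a near-maximal [y], half on the countable subfamily. Differentiating along [v] in [Y] moves
    [v] into the list of [y]'s, which is the next level. *)
Lemma supform_family j : (j <= k)%N -> exists t : nat -> tensor k n R * seq 'rV[R]_n,
  [/\ forall m x, form (t m).1 (t m).2 x <= supform j x,
    forall x e, 0 < e -> exists m, supform j x - e <= form (t m).1 (t m).2 x &
    (j < k)%N -> forall m x v, Y v ->
      `|form_diff (t m).1 (t m).2 x v| <= (k - j)%:R * supform j.+1 x].
Proof.
move=> jk; pose S := [set s : tensor k n R * seq 'rV[R]_n |
  [/\ dual_ball A s.1, size s.2 = j & forall i, Y (s.2)`_i]].
have S0 : S !=set0.
  exists (fun=> 0, nseq j 0); split; first exact: dual_ball0.
    by rewrite size_nseq.
  by move=> i; rewrite nth_nseq; case: ifP.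
have [t [tS tdense]] := countable_forms S0 (fun s (Ss : S s) => let: And3 _ h _ := Ss in h).
have tupS (y : seq 'rV[R]_n) : size y = j -> (forall i, Y y`_i) ->
    exists2 y' : j.-tuple 'rV[R]_n, tval y' = y & forall i : 'I_j, Y (tnth y' i).
  move=> sy Yy; have sy' : size y == j by apply/eqP.
  by exists (Tuple sy') => // i; rewrite (tnth_nth 0).
exists t; split=> [m x|x e e0|ltjk m x v Yv].
- have [du sy Yy] := tS m; have [y yE Yy'] := tupS _ sy Yy.
  apply: le_trans (ler_norm _) _; apply: le_trans (dual_ball_le _ du) _.
  by rewrite sy -yE; apply: supform_ub.
- have e20 : 0 < e / 2 by rewrite divr_gt0.
  have [_ [y Yy <-] ly] : exists2 r, form_values j x r & supform j x - e / 2 < r.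
    by apply: sup_adherent => //; split; [exact: form_values_neq0|exact: form_values_ub].
  have [u du uE] := dual_ball_attained A (tprod k (tval y ++ nseq (k - j) x)).
  have Suy : S (u, tval y).
    split => //=; first by rewrite size_tuple.
    move=> i; have [ij|ji] := ltnP i j; last by rewrite nth_default// size_tuple.
    by rewrite -[i]/(nat_of_ord (Ordinal ij)) -tnth_nth.
  have [m hm] := tdense _ x _ Suy e20; exists m.
  apply: le_trans hm; rewrite {1}/form size_tuple /= uE.
  by move: ly; set a := supform j x; set c := Num.norm _; lra.
- have [du sy Yy] := tS m; have usym := du.2 Asym.
  rewrite form_diffE// ?sy// normrM ger0_norm// ler_wpM2l//.
  apply: le_trans (dual_ball_le _ du) _.
  have sy' : size (rcons (t m).2 v) == j.+1 by rewrite size_rcons sy.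
  have -> : size (rcons (t m).2 v) = j.+1 by apply/eqP.
  apply: (@supform_ub j.+1 x (Tuple sy')) => i; rewrite (tnth_nth 0) /= nth_rcons sy.
  by case: ltngtP => // _.
Qed.

End SupForm.

(** * Downward induction over the suprema [F j] *)

Section Assembly.
Context {R : realType} {n : nat} {Psi : 'rV[R]_n -> R}.
Context {alpha beta K D : R} {mu : probability (borel_rV R n) R}.
Hypotheses (a1 : 1 < alpha) (ab : alpha <= beta) (b2 : 2 <= beta) (K1 : 1 <= K) (D0 : 0 < D).
Hypothesis PsiC : condition_C Psi.
Hypothesis Psi_convex : @convex_function R 'rV[R]_n [set: 'rV[R]_n] Psi.
Hypothesis PsiG : growth K alpha beta Psi.
Hypothesis mu_mLSI : mLSI mu Psi D.
Context {p : R}.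
Hypothesis bp : beta <= p.

Let p1 : 1 <= p. Proof. by move: b2 bp; lra. Qed.
Let C := mLSI_const alpha beta K D.
Let C0 : 0 < C. Proof. exact: mLSI_const_gt0. Qed.

Lemma sup_moment (a : R) (h F : 'rV[R]_n -> R) (u : nat -> 'rV[R]_n -> R)
    (du : nat -> 'rV[R]_n -> 'rV[R]_n -> R) :
  0 < a -> (forall x, 0 < h x) ->
  measurable_fun [set: borel_rV R n] (h : borel_rV R n -> R) ->
  moment_le mu p (h : borel_rV R n -> R) a ->
  (forall i, slope_le (A_set Psi p) h (u i) (du i)) ->
  (forall x, 0 <= F x) -> (forall i x, u i x <= F x) ->
  (forall x e, 0 < e -> exists i, F x - e <= u i x) ->
  mu.-integrable [set: borel_rV R n] (EFin \o (F : borel_rV R n -> R)) /\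
  moment_le mu p (fun x : borel_rV R n => F x - \int[mu]_x (F x)) (C * a).
Proof.
move=> a0 h0 mh hm us F0 uF usup; have h0' x : 0 <= h x by rewrite ltW.
have Ca0 : 0 < C * a by rewrite mulr_gt0.
have bg m : bounded_measurable (smooth_below (u := u) m : borel_rV R n -> R).
  split; last first.
    by exists (m%:R + 1) => x; have := norm_smooth_below_le F0 uF m x; rewrite le_min => /andP[].
  apply: continuous_measurable_rV; have [df [sf _]] := smooth_below_slope h0' us m.
  exact: smooth_continuous sf.
have gF x : smooth_below (u := u) m x @[m --> \oo] --> F x by exact: smooth_below_cvg.
have g_le m x : `|smooth_below (u := u) m x| <= F x + 1.
  by have := norm_smooth_below_le F0 uF m x; rewrite le_min => /andP[].
have gm m : moment_le mu p (fun x : borel_rV R n => smooth_below (u := u) m x -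
    \int[mu]_x (smooth_below (u := u) m x)) (C * a).
  have [df [sf dfh]] := smooth_below_slope h0' us m.
  exact: (bounded_moment a1 ab b2 K1 D0 PsiC Psi_convex PsiG mu_mLSI bp a0 sf
    (bg m).2 h0 mh dfh hm).
split; first exact: (limit_integrable p1 Ca0 bg gF g_le F0 gm).
exact: (limit_moment p1 Ca0 bg gF g_le F0 gm).
Qed.

Context {k : nat} {E : normedModType R} {A : tensor k n E}.
Hypothesis Asym : tensor_sym A.

Let F j : borel_rV R n -> R := supform A (A_set Psi p) j.
Let EF j : R := \int[mu]_x (F j x).

Let Y0 : A_set Psi p 0. Proof. by apply: A_set0 => //; move: p1; lra. Qed.

Let F0 j x : 0 <= F j x.
Proof. by have [b _ Yb] := A_set_bounded PsiC p; exact: supform_ge0 Y0 (fun y i => Yb y i) j x. Qed.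

Let EF0 j : 0 <= EF j.
Proof. exact: Rintegral_ge0. Qed.

(** The added [e] keeps the slope bound [h] strictly positive even where [F j.+1] vanishes; the
    factor 4 is the cost of adding it. *)
Let F_step j (a e : R) : (j < k)%N -> 0 <= a -> 0 < e ->
  measurable_fun [set: borel_rV R n] (F j.+1) -> moment_le mu p (F j.+1) a ->
  mu.-integrable [set: borel_rV R n] (EFin \o F j) /\
  moment_le mu p (fun x => F j x - EF j) (C * (4 * ((k - j)%:R * a + e))).
Proof.
move=> jk a0 e0 mF Fa; have [b _ Yb] := A_set_bounded PsiC p.
have [t [t_le t_sup t_diff]] := supform_family Y0 (fun y i => Yb y i) Asym (ltnW jk).
pose h x := (k - j)%:R * F j.+1 x + e.
have h0 x : 0 < h x by rewrite ltr_wpDl// mulr_ge0.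
have mkF : measurable_fun [set: borel_rV R n] (fun x => (k - j)%:R * F j.+1 x).
  exact: measurable_funM.
have mh : measurable_fun [set: borel_rV R n] h by exact: measurable_funD.
have ha : moment_le mu p h (4 * ((k - j)%:R * a + e)).
  have := moment_leD p1 _ _ mkF (measurable_cst e) (moment_leZ (k - j)%:R a0 mF Fa)
    (moment_le_cst mu p e).
  by rewrite ger0_norm// (gtr0_norm e0); apply; [exact: mulr_ge0 | exact: ltW].
apply: (sup_moment (h := h) (u := fun m => form (t m).1 (t m).2)
  (du := fun m => form_diff (t m).1 (t m).2)) => //.
- by rewrite mulr_gt0// ltr_wpDl// mulr_ge0.
- move=> m; split; first exact: smooth_form.
  by move=> x y Yy; apply: le_trans (t_diff jk m x y Yy) _; rewrite lerDl ltW.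
Qed.

(* The cost of one step of the downward induction on [j]: from a bound [a] on the
   norm of [F j.+1] to the bound [4 * (C * (4 * ((k - j) * a + e)) + EF j)]. *)
Definition chaos_rate := 16 * C * (k.+1)%:R + 4.

Let c1 : 1 <= chaos_rate.
Proof.
have : 0 <= C * k.+1%:R by rewrite mulr_ge0// ltW.
by rewrite /chaos_rate; lra.
Qed.

Let T e j : R := \sum_(j <= l < k.+1) EF l + e.

Let T0 e j : 0 < e -> 0 < T e j.
Proof. by move=> e0; rewrite ltr_wpDl// sumr_ge0. Qed.

(** Here [i = k - j]. Integrability is carried along so that [EF j] is a true mean when the
    deviation bound is turned into a bound on [F j]; [e] inside [T] absorbs the slack of each
    [F_step]. *)
Let F_moment e i j : 0 < e -> (i + j = k)%N ->
  mu.-integrable [set: borel_rV R n] (EFin \o F j) /\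
  moment_le mu p (F j) (chaos_rate ^+ i * T e j).
Proof.
move=> e0; elim: i j => [|i IHi] j ijk.
  have jk : j = k by [].
  have Fcst x : F j x = F j 0 by rewrite jk; exact: supform_full.
  have -> : F j = fun=> F j 0 by apply/funext.
  split; first exact: finite_measure_integrable_cst.
  have EFj : EF j = F j 0.
    by rewrite -(expectation_cst mu (F j 0)); congr Rintegral; apply/funext.
  apply: (moment_le_weaken p1 _ _ (moment_le_cst mu p (F j 0))) => //.
  rewrite expr0 mul1r ger0_norm ?F0// /T jk big_nat1 -jk EFj lerDl ltW//.
have jk : (j < k)%N by rewrite -ijk addSn ltnS leq_addl.
have [|intF1 F1] := IHi j.+1; first by rewrite addnS.
have mF1 : measurable_fun [set: borel_rV R n] (F j.+1).
  by apply/measurable_EFinP; apply: measurable_int intF1.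
have c1' := c1; set c := chaos_rate in c1' F1 *; set T1 := T e j.+1 in F1.
have T10 : 0 < T1 by exact: T0.
have ci : 1 <= c ^+ i by rewrite exprn_ege1.
have ciT0 : 0 <= c ^+ i * T1 := mulr_ge0 (le_trans ler01 ci) (ltW T10).
have [intF Fj] := F_step jk ciT0 e0 mF1 F1; split => //.
have mFj : measurable_fun [set: borel_rV R n] (fun x => F j x - EF j).
  by apply: measurable_funB => //; apply/measurable_EFinP; apply: measurable_int intF.
have -> : F j = fun x => (F j x - EF j) + EF j by apply/funext => x; rewrite subrK.
set B := C * _ in Fj; have B0 : 0 <= B.
  by rewrite mulr_ge0 ?(ltW C0)// mulr_ge0// addr_ge0 ?(ltW e0)// mulr_ge0.
have := moment_leD p1 B0 (normr_ge0 (EF j)) mFj (measurable_cst (EF j)) Fj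
  (moment_le_cst mu p (EF j)).
apply: moment_le_weaken => //; first by rewrite mulr_ge0// addr_ge0.
rewrite (ger0_norm (EF0 j)).
have TE : T e j = EF j + T1 by rewrite /T big_ltn ?addrA// ltnS ltnW.
have eT : e <= T1 by rewrite lerDr sumr_ge0.
have B_le : B <= C * (4 * (k.+1%:R * (c ^+ i * T1))).
  rewrite /B ler_wpM2l ?(ltW C0)// ler_wpM2l// -natr1 mulrDl mul1r lerD//.
    by rewrite ler_wpM2r// ler_nat leq_subr.
  by apply: le_trans eT _; rewrite ler_peMl// ltW.
have rE : c = 16 * C * k.+1%:R + 4 by [].
have ci0 : 0 < c ^+ i by apply: lt_le_trans ci.
rewrite exprS TE mulrDr.
have h1 : 4 * EF j <= c * c ^+ i * EF j.
  rewrite ler_wpM2r//; have c4 : 4 <= c.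
    by rewrite rE lerDr mulr_ge0// mulr_ge0// ltW.
  by apply: le_trans c4 _; rewrite ler_peMr// (le_trans ler01).
have h2 : 4 * B <= c * c ^+ i * T1.
  apply: (@le_trans _ _ (16 * C * k.+1%:R * (c ^+ i * T1))).
    by apply: le_trans (ler_wpM2l _ B_le) _ => //; rewrite le_eqVlt; apply/orP; left;
      apply/eqP; ring.
  by rewrite -[leRHS]mulrA ler_wpM2r// rE lerDl.
by move: h1 h2; lra.
Qed.

(** Half of it, [4 * C * (k + 1) * chaos_rate ^ k], comes from the last [F_step]; the other half
    pays for the slack [e] taken equal to the whole sum. *)
Definition chaos_const := 8 * C * k.+1%:R * chaos_rate ^+ k.

Lemma chaos_const_gt0 : 0 < chaos_const.
Proof.
exact: mulr_gt0 (mulr_gt0 (mulr_gt0 (ltr0Sn _ _) C0) (ltr0Sn _ _))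
  (exprn_gt0 _ (lt_le_trans ltr01 c1)).
Qed.

Lemma supform_integrable j : (j <= k)%N ->
  mu.-integrable [set: borel_rV R n] (EFin \o F j).
Proof. by move=> jk; exact: (F_moment ltr01 (subnK jk)).1. Qed.

Lemma supform_moment : (0 < k)%N ->
  moment_le mu p (fun x => F 0 x - EF 0) (chaos_const * \sum_(1 <= j < k.+1) EF j).
Proof.
move=> k0; set S := \sum_(1 <= j < k.+1) EF j.
have S0 : 0 <= S by apply: sumr_ge0.
have cc0 := chaos_const_gt0.
have main e : 0 < e -> moment_le mu p (fun x => F 0 x - EF 0) (chaos_const / 2 * (S + e)).
  move=> e0; have k1 : (k.-1 + 1 = k)%N by rewrite addn1 prednK.
  have [int1 F1] := F_moment e0 k1; rewrite /T -/S in F1.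
  have mF1 : measurable_fun [set: borel_rV R n] (F 1).
    by apply/measurable_EFinP; apply: measurable_int int1.
  have Se0 : 0 < S + e by rewrite ltr_wpDl.
  have c0 : 0 <= chaos_rate by apply: le_trans c1.
  have a0 : 0 <= chaos_rate ^+ k.-1 * (S + e) by rewrite mulr_ge0 ?exprn_ge0// ltW.
  have [_] := F_step k0 a0 e0 mF1 F1; rewrite subn0.
  have ck : 1 <= chaos_rate ^+ k by rewrite exprn_ege1.
  apply: moment_le_weaken => //.
    by rewrite mulr_ge0 ?(ltW C0)// mulr_ge0// addr_ge0 ?(ltW e0)// mulr_ge0.
  have -> : chaos_const / 2 * (S + e) =
      C * (4 * (k%:R * (chaos_rate ^+ k * (S + e)) + chaos_rate ^+ k * (S + e))).
    by rewrite /chaos_const -natr1; field.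
  rewrite ler_wpM2l ?(ltW C0)// ler_wpM2l// lerD//.
    by rewrite ler_wpM2l// ler_wpM2r ?(ltW Se0)// ler_weXn2l// leq_pred.
  have : 1 * (S + e) <= chaos_rate ^+ k * (S + e) by rewrite ler_wpM2r// ltW.
  by move: S0; lra.
(* A positive sum can itself serve as the slack. If the sum is zero, the slack is sent to 0 and the
   moment vanishes. *)
have [S_gt0|S_le0] := ltrP 0 S.
  have -> : chaos_const * S = chaos_const / 2 * (S + S) by field.
  exact: main.
have S_eq0 : S = 0 by apply/eqP; rewrite eq_le S_le0.
rewrite S_eq0 mulr0 /moment_le powR0; last by move: p1; case: eqP => // ->; rewrite ler10.
apply/lee_addgt0Pr => e e0; rewrite add0e.
have p0 : 0 < p by move: p1; lra.
have cc20 : 0 < chaos_const / 2 by rewrite divr_gt0.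
have e'0 : 0 < e `^ p^-1 / (chaos_const / 2) by rewrite divr_gt0 ?powR_gt0.
have := main _ e'0; rewrite /moment_le S_eq0 add0r mulrC divfK ?gt_eqF//.
by rewrite -powRrM mulVf ?gt_eqF// powRr1// ltW.
Qed.

End Assembly.

(** Multiples [c *: delta_mx 0 (i l)] in the [k] slots isolate the single entry [A i], up to
    [c ^+ k]. *)
Lemma supform_gt0 (R : realType) (n k : nat) (E : normedModType R) (A : tensor k n E)
    (Psi : 'rV[R]_n -> R) (p : R) x : condition_C Psi -> 1 <= p ->
  (exists i, A i != 0) -> 0 < supform A (A_set Psi p) k x.
Proof.
move=> PsiC p1 [i Ai]; have [b _ Yb] := A_set_bounded PsiC p.
have [c c0 cA] := A_set_delta PsiC.
have Y0 : A_set Psi p 0 by apply: A_set0 => //; lra.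
pose y := [tuple c *: (delta_mx 0 (i l) : 'rV[R]_n) | l < k].
have Yy l : A_set Psi p (tnth y l) by rewrite tnth_mktuple; exact: cA.
apply: lt_le_trans (supform_ub A (fun y i => Yb y i) x Yy).
have -> : pairing A (tprod k (tval y ++ nseq (k - k) x)) = c ^+ k *: A i.
  rewrite /pairing (bigD1 i) //= big1 ?addr0 => [|j ji].
    congr (_ *: _); rewrite /tprod subnn cats0.
    rewrite (eq_bigr (fun=> c)) ?prodr_const ?card_ord// => l _.
    by rewrite -(tnth_nth 0 y l) tnth_mktuple !mxE !eqxx mulr1.
  have [l jl] : exists l, j l != i l.
    by apply/existsP; rewrite -negb_forall; apply: contraNN ji => /forallP h;
      apply/eqP/ffunP => l; apply/eqP.
  rewrite /tprod subnn cats0 (bigD1 l) //= -(tnth_nth 0 y l) tnth_mktuple !mxE eqxx /=.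
  by rewrite (negbTE jl) mulr0 mul0r scale0r.
by rewrite normrZ mulr_gt0 ?normr_gt0// gt_eqF// exprn_gt0.
Qed.

Lemma supform0 (R : realType) (n k : nat) (E : normedModType R) (A : tensor k n E)
    (Y : set 'rV[R]_n) x : supform A Y 0 x = `|pairing A (tprod k (nseq k x))|.
Proof.
rewrite /supform; have -> : form_values A Y 0 x = [set `|pairing A (tprod k (nseq k x))|].
  apply/seteqP; split=> [_ [y _ <-]|_ ->] /=.
    by rewrite (tuple0 y) /= subn0.
  by exists [tuple] => [[]//|]; rewrite /= subn0.
exact: sup1.
Qed.

(** Markov for the [p]-th power: at level [expR 1 * B] the ratio of powers is exactly
    [expR (- p)]. *)
Lemma moment_le_tail (d : measure_display) (T : measurableType d) (R : realType)
    (P : probability T R) (p B : R) (Y : T -> R) : 0 < p -> 0 < B ->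
  measurable_fun [set: T] Y -> moment_le P p Y B ->
  (P [set w | ((expR 1 * B)%:E <= `|(Y w)%:E|)%E] <= (expR (- p))%:E)%E.
Proof.
move=> p0 B0 mY YB; set G := [set w | _].
have eB0 : 0 < expR 1 * B by rewrite mulr_gt0 ?expR_gt0.
have mG : measurable G.
  have -> : G = (fun w => `|Y w|) @^-1` `[expR 1 * B, +oo[%classic.
    by apply/seteqP; split=> w; rewrite /G /= lee_fin in_itv/= andbT.
  by rewrite -[X in measurable X]setTI; apply: measurableT_comp.
have Bp0 : 0 < B `^ p by rewrite powR_gt0.
have : (((expR 1 * B) `^ p)%:E * P G <= (B `^ p)%:E)%E.
  apply: le_trans YB; rewrite -[G]setIT -integral_indic//.
  rewrite -ge0_integralZl_EFin//; last 2 first.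
  - by apply/measurable_EFinP; exact: measurable_indic.
  - exact: powR_ge0.
  apply: ge0_le_integralT => w; rewrite -EFinM lee_fin indicE.
    by rewrite mulr_ge0// powR_ge0.
  have [wG|] := boolP (w \in G); last by rewrite mulr0 powR_ge0.
  move/set_mem: wG; rewrite /G /= lee_fin mulr1 => wG.
  by rewrite ge0_ler_powR ?nnegrE// ltW.
have : P G \is a fin_num by rewrite fin_num_measure.
case: (P G) => [u| |] // _; rewrite powRM ?expR_ge0 ?(ltW B0)// -expRM mul1r.
rewrite -EFinM !lee_fin mulrAC -[leRHS]mul1r ler_pM2r// => h.
by rewrite expRN -[leRHS]mul1r ler_pdivlMr ?expR_gt0// mulrC.
Qed.

Theorem theorem3p10 (R : realType) (alpha beta K D : R) (k : nat) :
  1 < alpha -> alpha <= 2 -> 2 <= beta -> 1 <= K -> 0 < D -> (1 <= k)%N ->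
  exists C C' : R, [/\ 0 < C, 0 < C' &
    forall (n : nat) (Psi : 'rV[R]_n -> R),
    @convex_function R 'rV[R]_n [set: 'rV[R]_n] Psi ->
    condition_C Psi -> growth K alpha beta Psi ->
    forall (d : measure_display) (T : measurableType d) (P : probability T R)
      (X : {RV P >-> borel_rV R n}),
    distribution P X `<< @lebesgue_rV R n ->
    mLSI (distribution P X) Psi D ->
    forall E : completeNormedModType R, separable E ->
    forall A : tensor k n E, tensor_sym A ->
    let Z := fun w : T => `|pairing A (tprod k (nseq k (X w : 'rV[R]_n)))| in
    forall p : R, beta <= p ->
    let dev := fun w : T => ((Z w)%:E - 'E_P[Z])%E in
    let S := (\sum_(1 <= j < k.+1) Esup P X A Psi p j)%E in
    ('N[P]_(p%:E)[dev] <= C%:E * S)%E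
    /\
    (* for A = 0 both sides of the event are 0 and its probability is 1 *)
    ((exists i, A i != 0) ->
     (P [set w | C'%:E * S <= `|dev w|] <= (expR (- p))%:E)%E)].
Proof.
move=> a1 a2 b2 K1 D0 k1; have ab : alpha <= beta by apply: le_trans b2.
pose C := @chaos_const R alpha beta K D k.
have C0 : 0 < C by exact: chaos_const_gt0.
exists C, (expR 1 * C); split => //; first by rewrite mulr_gt0// expR_gt0.
move=> n Psi Psi_convex PsiC PsiG d T P X _ mu_mLSI E _ A Asym Z p bp dev S.
have p2 : 2 <= p by apply: le_trans bp.
have p0 : 0 < p by lra.
have p1 : 1 <= p by lra.
set mu := distribution P X in mu_mLSI.
pose F j : borel_rV R n -> R := supform A (A_set Psi p) j.
have [b _ Yb] := A_set_bounded PsiC p.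
have Yb' : forall y i, A_set Psi p y -> `|y 0 i| <= b by move=> y i; apply: Yb.
have Y0 : A_set Psi p 0 by apply: A_set0 => //; exact: ltW.
have F0 j x : 0 <= F j x by exact: supform_ge0 Y0 Yb' j x.
have intF j : (j <= k)%N -> mu.-integrable [set: borel_rV R n] (EFin \o F j).
  exact: (supform_integrable a1 ab b2 K1 D0 PsiC Psi_convex PsiG mu_mLSI bp Asym).
have mF j : (j <= k)%N -> measurable_fun [set: borel_rV R n] (EFin \o F j).
  by move=> jk; exact: measurable_int (intF j jk).
pose EF j : R := \int[mu]_x (F j x).
have EF0 j : 0 <= EF j by exact: Rintegral_ge0.
have EFE j : (j <= k)%N -> (\int[P]_w (F j (X w))%:E = (EF j)%:E)%E.
  move=> jk; rewrite -(expectation_EFin (intF j jk)).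
  by rewrite (ge0_integral_distribution X (mF j jk))// => x; rewrite lee_fin F0.
have EsupE j : (j <= k)%N -> Esup P X A Psi p j = (EF j)%:E.
  move=> jk; rewrite -(EFE j jk); apply: eq_integral => w _.
  by rewrite -(ereal_sup_form_values A Y0 Yb') /form_values image_comp.
have ZE w : Z w = F 0 (X w) by rewrite /F supform0.
have EZ : ('E_P[Z] = (EF 0)%:E)%E.
  by rewrite unlock -(EFE 0)//; apply: eq_integral => w _; rewrite ZE.
pose s := \sum_(1 <= j < k.+1) EF j.
have SE : S = s%:E.
  rewrite /S /s -sumEFin big_nat [RHS]big_nat; apply: eq_bigr => j /andP[_ jk].
  exact: EsupE.
pose Y w : R := F 0 (X w) - EF 0.
have devE w : dev w = (Y w)%:E by rewrite /dev EZ ZE.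
have mF0 : measurable_fun [set: borel_rV R n] (fun x => F 0 x - EF 0).
  by apply: measurable_funB => //; apply/measurable_EFinP; exact: mF.
have mY : measurable_fun [set: T] Y.
  by apply: (measurableT_comp mF0); exact: measurable_funPT.
have YB : moment_le P p Y (C * s).
  have := supform_moment a1 ab b2 K1 D0 PsiC Psi_convex PsiG mu_mLSI bp Asym k1.
  rewrite /moment_le (ge0_integral_distribution X (measurable_powR_norm p mF0))//.
have s0 : 0 <= s by apply: sumr_ge0.
split.
  rewrite SE -EFinM unlock; apply: (@le_trans _ _ (((C * s) `^ p)%:E `^ p^-1)%E).
    apply: gt0_ler_poweR; rewrite ?invr_ge0 ?(ltW p0)// ?in_itv/= ?andbT ?leey.
    - by rewrite andbT integral_ge0// => w _; rewrite poweR_ge0.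
    - by rewrite andbT lee_fin powR_ge0.
    - by under eq_integral do rewrite devE.
  by rewrite poweR_EFin -powRrM mulfV ?gt_eqF// powRr1// mulr_ge0// ltW.
(* The last summand is the constant [F k], positive as soon as one entry of [A] is not zero; Markov
   needs this positive level. *)
move=> A_neq0; have s_gt0 : 0 < s.
  have Fk : 0 < F k 0 by exact: supform_gt0.
  apply: lt_le_trans Fk _.
  have -> : F k 0 = EF k.
    rewrite -(expectation_cst mu (F k 0)); congr Rintegral.
    by apply/funext => x; exact: supform_full.
  by rewrite /s big_nat_recr//= lerDr sumr_ge0.
have := moment_le_tail p0 (mulr_gt0 C0 s_gt0) mY YB.
apply: le_trans; rewrite le_eqVlt; apply/orP; left; apply/eqP; congr (P _).
by apply/seteqP; split=> w /=; rewrite devE SE -EFinM -(mulrA (expR 1) C s).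
Qed.
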